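(* Let $\mathcal{V}$ be a braided monoidal additive category with finite direct sums and splitting of idempotents. Assume also that multiplication by $2$ is invertible in each hom abelian group $\mathcal{V}(X,Y)$. Then the functor $\Phi:\mathbf{CA}\to\mathbf{VPA}$, taking each composition algebra $A$ in $\mathcal{V}$ to the vector product algebra $V$ obtained by splitting the idempotent $1_A-e\circ p$ on $A$ (with the self-duality and the wedge described in the context), and each morphism of composition algebras to its restriction, is an equivalence of categories.
   Context: A braided monoidal additive category $\mathcal{V}$ is a braided monoidal category (tensor $\otimes$, unit $I$, braiding $c_{X,Y}:X\otimes Y\to Y\otimes X$; associativity and unit constraints are suppressed) whose hom-sets are abelian groups such that composition and tensor product are additive in each variable. A self-duality $A\dashv A$ consists of a counit $\cup:A\otimes A\to I$ (also written $\bullet$) and a unit $\cap:I\to A\otimes A$ satisfying $(\cup\otimes 1_A)(1_A\otimes\cap)=1_A=(1_A\otimes\cup)(\cap\otimes 1_A)$. It is symmetric when $\cup\circ c_{A,A}=\cup$. A vector product algebra in $\mathcal{V}$ is an object $V$ with a symmetric self-duality $V\dashv V$ and a morphism $\wedge:V\otimes V\to V$ such that: (1) $\wedge\circ c_{V,V}=-\wedge$; (2) $\cup(\wedge\otimes 1_V)=\cup(\wedge\otimes 1_V)c_{V\otimes V,V}$; (3) $\wedge(\wedge\otimes 1_V)+\wedge(1_V\otimes\wedge)=2(\cup\otimes 1_V)(1_V\otimes c_{V,V})-(\cup\otimes 1_V)-(1_V\otimes\cup)$. A composition algebra in $\mathcal{V}$ is an object $A$ with a symmetric self-duality $A\dashv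 A$, a multiplication $m:A\otimes A\to A$ and an identity $e:I\to A$ such that: (a) $\cup(e\otimes e)=1_I$; (b) $m\,c_{A,A}\,c_{A,A}=m$; (c) $m(e\otimes 1_A)=1_A=m(1_A\otimes e)$; (d) $\cup(m\otimes m)(1_A\otimes c_{A,A}\otimes 1_A)+\cup(m\otimes m)(1_A\otimes c_{A\otimes A,A})=2(\cup\otimes\cup)$ as morphisms $A\otimes A\otimes A\otimes A\to I$. $\mathbf{CA}$ is the category of composition algebras in $\mathcal{V}$; a morphism $f:A\to B$ is a morphism of $\mathcal{V}$ with $\cup_B(f\otimes f)=\cup_A$, $m_B(f\otimes f)=f m_A$ and $f e_A=e_B$. $\mathbf{VPA}$ is the category of vector product algebras in $\mathcal{V}$; a morphism $h:V\to W$ is a morphism of $\mathcal{V}$ with $\cup_W(h\otimes h)=\cup_V$ and $\wedge_W(h\otimes h)=h\wedge_V$. Definition of $\Phi$. For a composition algebra $A$ put $p=\cup(1_A\otimes e):A\to I$, so $pe=1_I$. Splitting the idempotent $1_A-ep$ gives $q:A\to V$ and $i:V\to A$ with $qi=1_V$, $iq=1_A-ep$ (so $A\cong I\oplus V$). Define $\wedge_A:A\otimes A\to A$ by $2\wedge_A=m-m\,c_{A,A}$. Then $\Phi(A)=V$ with counit $\cup(i\otimes i)$, unit $(q\otimes q)\cap$, and wedge $\wedge_V=q\circ\wedge_A\circ(i\otimes i)$. For $f:A\to B$ in $\mathbf{CA}$, $\Phi(f)=q_B\circ f\circ i_A$ is the restriction of $f$. *)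

(* Defs.v *)
From mathcomp Require Import all_boot all_algebra.
From mathcomp Require Import boolp.

Set Implicit Arguments.
Unset Strict Implicit.
Unset Printing Implicit Defensive.

Import GRing.Theory.
Local Open Scope ring_scope.

Declare Scope cat_scope.
Delimit Scope cat_scope with cat.

Record category := Category {
  ob :> Type;
  mor : ob -> ob -> Type;
  idm : forall X, mor X X;
  compm : forall X Y Z, mor Y Z -> mor X Y -> mor X Z;
  compmA : forall X Y Z T (h : mor Z T) (g : mor Y Z) (f : mor X Y),
    compm h (compm g f) = compm (compm h g) f;
  compm1l : forall X Y (f : mor X Y), compm (idm Y) f = f;
  compm1r : forall X Y (f : mor X Y), compm f (idm X) = f }.

Arguments idm {_} _.
Arguments compm {_ _ _ _} _ _.

Record functor (C D : category) := Functor {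
  fob :> C -> D;
  fmor : forall X Y, mor X Y -> mor (fob X) (fob Y);
  fmor1 : forall X, fmor (idm X) = idm (fob X);
  fmorM : forall X Y Z (g : mor Y Z) (f : mor X Y),
    fmor (compm g f) = compm (fmor g) (fmor f) }.

Arguments fmor {_ _} _ {_ _} _.

Definition functor_id (C : category) : functor C C :=
  @Functor C C (fun X => X) (fun _ _ f => f)
    (fun _ => erefl) (fun _ _ _ _ _ => erefl).

Definition functor_comp (C D E : category) (G : functor D E) (F : functor C D) :
  functor C E.
Proof.
exists (fun X => G (F X)) (fun _ _ f => fmor G (fmor F f)).
- by move=> X; rewrite !fmor1.
- by move=> X Y Z g f; rewrite !fmorM.
Defined.

Record natural_iso (C D : category) (F G : functor C D) := NaturalIso {
  nti : forall X, mor (F X) (G X);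
  nti_inv : forall X, mor (G X) (F X);
  nti_nat : forall X Y (f : mor X Y),
    compm (nti Y) (fmor F f) = compm (fmor G f) (nti X);
  ntiK : forall X, compm (nti_inv X) (nti X) = idm (F X);
  ntiVK : forall X, compm (nti X) (nti_inv X) = idm (G X) }.

Definition is_equivalence (C D : category) (F : functor C D) : Prop :=
  exists G : functor D C,
    inhabited (natural_iso (functor_comp G F) (functor_id C)) /\
    inhabited (natural_iso (functor_comp F G) (functor_id D)).

Record preadditive := Preadditive {
  pob :> Type;
  hom : pob -> pob -> zmodType;
  id1 : forall X, hom X X;
  comp : forall X Y Z, hom Y Z -> hom X Y -> hom X Z;
  compA : forall X Y Z T (h : hom Z T) (g : hom Y Z) (f : hom X Y),
    comp h (comp g f) = comp (comp h g) f;
  comp1l : forall X Y (f : hom X Y), comp (id1 Y) f = f;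
  comp1r : forall X Y (f : hom X Y), comp f (id1 X) = f;
  compDl : forall X Y Z (g g' : hom Y Z) (f : hom X Y),
    comp (g + g') f = comp g f + comp g' f;
  compDr : forall X Y Z (g : hom Y Z) (f f' : hom X Y),
    comp g (f + f') = comp g f + comp g f' }.

Arguments id1 {_} _.
Arguments comp {_ _ _ _} _ _.

Notation "g ∘ f" := (comp g f) (at level 40, left associativity) : cat_scope.
Local Open Scope cat_scope.

(* The associator and the unitors are kept explicit: the category is not
   assumed to be strict. *)
Record monoidal_additive := MonoidalAdditive {
  mcat :> preadditive;
  unit_ob : mcat;
  tens : mcat -> mcat -> mcat;
  tensm : forall X X' Y Y',
    hom X X' -> hom Y Y' -> hom (tens X Y) (tens X' Y');
  tensm1 : forall X Y, tensm (id1 X) (id1 Y) = id1 (tens X Y);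
  tensmM : forall X X' X'' Y Y' Y'' (f' : hom X' X'') (f : hom X X')
      (g' : hom Y' Y'') (g : hom Y Y'),
    tensm (f' ∘ f) (g' ∘ g) = tensm f' g' ∘ tensm f g;
  tensmDl : forall X X' Y Y' (f f' : hom X X') (g : hom Y Y'),
    tensm (f + f') g = tensm f g + tensm f' g;
  tensmDr : forall X X' Y Y' (f : hom X X') (g g' : hom Y Y'),
    tensm f (g + g') = tensm f g + tensm f g';
  assoc : forall X Y Z, hom (tens (tens X Y) Z) (tens X (tens Y Z));
  assocV : forall X Y Z, hom (tens X (tens Y Z)) (tens (tens X Y) Z);
  assocK : forall X Y Z, assocV X Y Z ∘ assoc X Y Z = id1 _;
  assocVK : forall X Y Z, assoc X Y Z ∘ assocV X Y Z = id1 _;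
  assoc_nat : forall X X' Y Y' Z Z'
      (f : hom X X') (g : hom Y Y') (h : hom Z Z'),
    assoc X' Y' Z' ∘ tensm (tensm f g) h = tensm f (tensm g h) ∘ assoc X Y Z;
  lunit : forall X, hom (tens unit_ob X) X;
  lunitV : forall X, hom X (tens unit_ob X);
  lunitK : forall X, lunitV X ∘ lunit X = id1 _;
  lunitVK : forall X, lunit X ∘ lunitV X = id1 _;
  lunit_nat : forall X Y (f : hom X Y),
    lunit Y ∘ tensm (id1 unit_ob) f = f ∘ lunit X;
  runit : forall X, hom (tens X unit_ob) X;
  runitV : forall X, hom X (tens X unit_ob);
  runitK : forall X, runitV X ∘ runit X = id1 _;
  runitVK : forall X, runit X ∘ runitV X = id1 _;
  runit_nat : forall X Y (f : hom X Y),
    runit Y ∘ tensm f (id1 unit_ob) = f ∘ runit X;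
  pentagon : forall X Y Z T,
    assoc X Y (tens Z T) ∘ assoc (tens X Y) Z T =
    tensm (id1 X) (assoc Y Z T) ∘ assoc X (tens Y Z) T
      ∘ tensm (assoc X Y Z) (id1 T);
  triangle : forall X Y,
    tensm (id1 X) (lunit Y) ∘ assoc X unit_ob Y = tensm (runit X) (id1 Y) }.

Arguments unit_ob {_}.
Arguments tens {_} _ _.
Arguments tensm {_ _ _ _ _} _ _.
Arguments assoc {_} _ _ _.
Arguments assocV {_} _ _ _.
Arguments lunit {_} _.
Arguments lunitV {_} _.
Arguments runit {_} _.
Arguments runitV {_} _.

Notation "'𝟙'" := unit_ob (at level 0) : cat_scope.
Notation "X ⊗ Y" := (tens X Y) (at level 38, left associativity) : cat_scope.
Notation "f ⊠ g" := (tensm f g) (at level 38, left associativity) : cat_scope.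

Record braided_additive := BraidedAdditive {
  bcat :> monoidal_additive;
  braid : forall X Y : bcat, hom (X ⊗ Y) (Y ⊗ X);
  braidV : forall X Y : bcat, hom (Y ⊗ X) (X ⊗ Y);
  braidK : forall X Y, braidV X Y ∘ braid X Y = id1 _;
  braidVK : forall X Y, braid X Y ∘ braidV X Y = id1 _;
  braid_nat : forall (X X' Y Y' : bcat) (f : hom X X') (g : hom Y Y'),
    braid X' Y' ∘ (f ⊠ g) = (g ⊠ f) ∘ braid X Y;
  hexagon : forall X Y Z : bcat,
    assoc Y Z X ∘ braid X (Y ⊗ Z) ∘ assoc X Y Z =
    (id1 Y ⊠ braid X Z) ∘ assoc Y X Z ∘ (braid X Y ⊠ id1 Z);
  hexagonV : forall X Y Z : bcat,
    assocV Z X Y ∘ braid (X ⊗ Y) Z ∘ assocV X Y Z =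
    (braid X Z ⊠ id1 Y) ∘ assocV X Z Y ∘ (id1 X ⊠ braid Y Z) }.

Arguments braid {_} _ _.
Arguments braidV {_} _ _.

Definition is_direct_sum (C : preadditive) (n : nat) (X : 'I_n -> C) (S : C)
    (inj : forall k, hom (X k) S) (prj : forall k, hom S (X k)) : Prop :=
  [/\ forall k, prj k ∘ inj k = id1 (X k),
      forall j k, j != k -> prj k ∘ inj j = 0
    & \sum_(k < n) (inj k ∘ prj k) = id1 S].

(* The case n = 0 provides a zero object. *)
Definition has_finite_direct_sums (C : preadditive) : Prop :=
  forall (n : nat) (X : 'I_n -> C),
    exists (S : C) (inj : forall k, hom (X k) S) (prj : forall k, hom S (X k)),
      is_direct_sum inj prj.

Record splitting (C : preadditive) (X : C) (a : hom X X) := Splitting {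
  spl_ob : C;
  spl_q : hom X spl_ob;
  spl_i : hom spl_ob X;
  spl_qi : spl_q ∘ spl_i = id1 spl_ob;
  spl_iq : spl_i ∘ spl_q = a }.

Definition idempotents_split (C : preadditive) : Prop :=
  forall (X : C) (a : hom X X), a ∘ a = a -> inhabited (splitting a).

Definition two_invertible (C : preadditive) : Prop :=
  forall X Y : C, bijective (fun f : hom X Y => f *+ 2).

Section Half.
Variables (C : preadditive) (C2 : two_invertible C) (X Y : C).

Lemma half_exists (f : hom X Y) : exists g : hom X Y, g *+ 2 == f.
Proof. by have [h _ hK] := C2 X Y; exists (h f); rewrite hK. Qed.

Definition half (f : hom X Y) : hom X Y := xchoose (half_exists f).

Lemma halfK (f : hom X Y) : half f *+ 2 = f.
Proof. exact/eqP/(xchooseP (half_exists f)). Qed.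

End Half.

Record is_symmetric_self_duality (C : braided_additive) (A : C)
    (cup : hom (A ⊗ A) 𝟙) (cap : hom 𝟙 (A ⊗ A)) : Prop := {
  snakel : lunit A ∘ (cup ⊠ id1 A) ∘ assocV A A A ∘ (id1 A ⊠ cap) ∘ runitV A
    = id1 A;
  snaker : runit A ∘ (id1 A ⊠ cup) ∘ assoc A A A ∘ (cap ⊠ id1 A) ∘ lunitV A
    = id1 A;
  cup_sym : cup ∘ braid A A = cup }.

Record vpa_data (C : braided_additive) := VPAData {
  vpa_ob : C;
  vpa_cup : hom (vpa_ob ⊗ vpa_ob) 𝟙;
  vpa_cap : hom 𝟙 (vpa_ob ⊗ vpa_ob);
  vpa_wedge : hom (vpa_ob ⊗ vpa_ob) vpa_ob }.

(* In the last two axioms the three-fold tensor power is bracketed as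
   (V ⊗ V) ⊗ V. *)
Record is_vpa (C : braided_additive) (D : vpa_data C) : Prop := {
  vpa_dual : is_symmetric_self_duality (vpa_cup D) (vpa_cap D);
  vpa_anti : let V := vpa_ob D in let wedge := vpa_wedge D in
    wedge ∘ braid V V = - wedge;
  vpa_cyclic : let V := vpa_ob D in
    let cup := vpa_cup D in let wedge := vpa_wedge D in
    cup ∘ (wedge ⊠ id1 V)
    = cup ∘ (wedge ⊠ id1 V) ∘ assocV V V V ∘ braid (V ⊗ V) V;
  vpa_double : let V := vpa_ob D in
    let cup := vpa_cup D in let wedge := vpa_wedge D in
    wedge ∘ (wedge ⊠ id1 V) + wedge ∘ (id1 V ⊠ wedge) ∘ assoc V V V
    = (lunit V ∘ (cup ⊠ id1 V) ∘ assocV V V V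
        ∘ (id1 V ⊠ braid V V) ∘ assoc V V V) *+ 2
      - lunit V ∘ (cup ⊠ id1 V)
      - runit V ∘ (id1 V ⊠ cup) ∘ assoc V V V }.

Record vpa (C : braided_additive) := VPAlg {
  vpa_val :> vpa_data C;
  vpaP : is_vpa vpa_val }.

Definition is_vpa_mor (C : braided_additive) (V W : vpa_data C)
    (h : hom (vpa_ob V) (vpa_ob W)) : Prop :=
  vpa_cup W ∘ (h ⊠ h) = vpa_cup V /\
  vpa_wedge W ∘ (h ⊠ h) = h ∘ vpa_wedge V.

Record ca_data (C : braided_additive) := CAData {
  ca_ob : C;
  ca_cup : hom (ca_ob ⊗ ca_ob) 𝟙;
  ca_cap : hom 𝟙 (ca_ob ⊗ ca_ob);
  ca_mul : hom (ca_ob ⊗ ca_ob) ca_ob;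
  ca_e : hom 𝟙 ca_ob }.

(* The morphisms 1 ⊗ c_{A,A} ⊗ 1 and 1 ⊗ c_{A⊗A,A}, with both the source and the
   target bracketed as (A ⊗ A) ⊗ (A ⊗ A). *)
Definition braid_mid (C : braided_additive) (A : C) :
    hom ((A ⊗ A) ⊗ (A ⊗ A)) ((A ⊗ A) ⊗ (A ⊗ A)) :=
  assocV A A (A ⊗ A)
  ∘ (id1 A ⊠ (assoc A A A ∘ (braid A A ⊠ id1 A) ∘ assocV A A A))
  ∘ assoc A A (A ⊗ A).

Definition braid_last (C : braided_additive) (A : C) :
    hom ((A ⊗ A) ⊗ (A ⊗ A)) ((A ⊗ A) ⊗ (A ⊗ A)) :=
  assocV A A (A ⊗ A)
  ∘ (id1 A ⊠ (braid (A ⊗ A) A ∘ assocV A A A))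
  ∘ assoc A A (A ⊗ A).

Record is_ca (C : braided_additive) (D : ca_data C) : Prop := {
  ca_dual : is_symmetric_self_duality (ca_cup D) (ca_cap D);
  ca_norm_e : ca_cup D ∘ (ca_e D ⊠ ca_e D) ∘ runitV 𝟙 = id1 𝟙;
  ca_braid2 : let A := ca_ob D in
    ca_mul D ∘ braid A A ∘ braid A A = ca_mul D;
  ca_mul1l : let A := ca_ob D in
    ca_mul D ∘ (ca_e D ⊠ id1 A) ∘ lunitV A = id1 A;
  ca_mul1r : let A := ca_ob D in
    ca_mul D ∘ (id1 A ⊠ ca_e D) ∘ runitV A = id1 A;
  ca_comp : let A := ca_ob D in let cup := ca_cup D in let m := ca_mul D in
    cup ∘ (m ⊠ m) ∘ braid_mid A + cup ∘ (m ⊠ m) ∘ braid_last A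
    = (runit 𝟙 ∘ (cup ⊠ cup)) *+ 2 }.

Record calg (C : braided_additive) := CAlg {
  ca_val :> ca_data C;
  caP : is_ca ca_val }.

Record is_ca_mor (C : braided_additive) (A B : ca_data C)
    (f : hom (ca_ob A) (ca_ob B)) : Prop := {
  ca_mor_cup : ca_cup B ∘ (f ⊠ f) = ca_cup A;
  ca_mor_mul : ca_mul B ∘ (f ⊠ f) = f ∘ ca_mul A;
  ca_mor_e : f ∘ ca_e A = ca_e B }.

Arguments is_vpa_mor {C} V W h.
Arguments is_ca_mor {C} A B f.

Section Categories.
Variable C : braided_additive.

Record ca_hom (A B : calg C) := CAHom {
  ca_hom_val : hom (ca_ob A) (ca_ob B);
  ca_homP : is_ca_mor A B ca_hom_val }.

Record vpa_hom (V W : vpa C) := VPAHom {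
  vpa_hom_val : hom (vpa_ob V) (vpa_ob W);
  vpa_homP : is_vpa_mor V W vpa_hom_val }.

Lemma ca_hom_inj A B (f g : ca_hom A B) : ca_hom_val f = ca_hom_val g -> f = g.
Proof.
case: f g => [f fP] [g gP] /= fg; case: _ / fg gP => gP.
by rewrite (Prop_irrelevance fP gP).
Qed.

Lemma vpa_hom_inj V W (f g : vpa_hom V W) :
  vpa_hom_val f = vpa_hom_val g -> f = g.
Proof.
case: f g => [f fP] [g gP] /= fg; case: _ / fg gP => gP.
by rewrite (Prop_irrelevance fP gP).
Qed.

Lemma is_ca_mor1 (A : calg C) : is_ca_mor A A (id1 (ca_ob A)).
Proof. by split; rewrite ?tensm1 ?comp1l ?comp1r. Qed.

Lemma is_vpa_mor1 (V : vpa C) : is_vpa_mor V V (id1 (vpa_ob V)).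
Proof. by split; rewrite ?tensm1 ?comp1l ?comp1r. Qed.

Lemma is_ca_morM (A B D : calg C) (g : hom (ca_ob B) (ca_ob D))
    (f : hom (ca_ob A) (ca_ob B)) :
  is_ca_mor B D g -> is_ca_mor A B f -> is_ca_mor A D (g ∘ f).
Proof.
move=> [gc gm ge] [fc fm fe]; split; rewrite ?tensmM ?compA.
- by rewrite gc.
- by rewrite gm -compA fm compA.
- by rewrite -compA fe.
Qed.

Lemma is_vpa_morM (U V W : vpa C) (g : hom (vpa_ob V) (vpa_ob W))
    (f : hom (vpa_ob U) (vpa_ob V)) :
  is_vpa_mor V W g -> is_vpa_mor U V f -> is_vpa_mor U W (g ∘ f).
Proof.
move=> [gc gw] [fc fw]; split; rewrite tensmM !compA.
- by rewrite gc.
- by rewrite gw -compA fw compA.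
Qed.

Definition CA : category.
Proof.
exists (calg C) ca_hom (fun A => CAHom (is_ca_mor1 A))
  (fun _ _ _ g f => CAHom (is_ca_morM (ca_homP g) (ca_homP f))).
- by move=> *; apply: ca_hom_inj; rewrite /= compA.
- by move=> *; apply: ca_hom_inj; rewrite /= comp1l.
- by move=> *; apply: ca_hom_inj; rewrite /= comp1r.
Defined.

Definition VPA : category.
Proof.
exists (vpa C) vpa_hom (fun V => VPAHom (is_vpa_mor1 V))
  (fun _ _ _ g f => VPAHom (is_vpa_morM (vpa_homP g) (vpa_homP f))).
- by move=> *; apply: vpa_hom_inj; rewrite /= compA.
- by move=> *; apply: vpa_hom_inj; rewrite /= comp1l.
- by move=> *; apply: vpa_hom_inj; rewrite /= comp1r.
Defined.

End Categories.

Definition ca_p (C : braided_additive) (A : ca_data C) : hom (ca_ob A) 𝟙 :=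
  ca_cup A ∘ (id1 (ca_ob A) ⊠ ca_e A) ∘ runitV (ca_ob A).

Definition ca_im (C : braided_additive) (A : ca_data C) :
    hom (ca_ob A) (ca_ob A) :=
  id1 (ca_ob A) - ca_e A ∘ ca_p A.

Lemma comp0l (C : preadditive) (X Y Z : C) (f : hom X Y) : (0 : hom Y Z) ∘ f = 0.
Proof. by apply: (addrI ((0 : hom Y Z) ∘ f)); rewrite -compDl !addr0. Qed.

Lemma comp0r (C : preadditive) (X Y Z : C) (g : hom Y Z) : g ∘ (0 : hom X Y) = 0.
Proof. by apply: (addrI (g ∘ (0 : hom X Y))); rewrite -compDr !addr0. Qed.

Lemma compNl (C : preadditive) (X Y Z : C) (g : hom Y Z) (f : hom X Y) :
  (- g) ∘ f = - (g ∘ f).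
Proof. by apply/eqP; rewrite -addr_eq0 -compDl addNr comp0l. Qed.

Lemma compNr (C : preadditive) (X Y Z : C) (g : hom Y Z) (f : hom X Y) :
  g ∘ (- f) = - (g ∘ f).
Proof. by apply/eqP; rewrite -addr_eq0 -compDr addNr comp0r. Qed.

Lemma ca_pe (C : braided_additive) (A : calg C) : ca_p A ∘ ca_e A = id1 𝟙.
Proof.
have runitV_nat (X Y : C) (f : hom X Y) :
    runitV Y ∘ f = (f ⊠ id1 𝟙) ∘ runitV X.
  rewrite -[LHS]comp1r -(runitVK X) compA -(compA (runitV Y)) -runit_nat compA.
  by rewrite runitK comp1l.
rewrite /ca_p -compA runitV_nat compA -(compA (ca_cup A)) -tensmM.
by rewrite comp1l comp1r; case: (caP A).
Qed.

Lemma ca_im_idem (C : braided_additive) (A : calg C) :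
  ca_im A ∘ ca_im A = ca_im A.
Proof.
rewrite {1}/ca_im compDl comp1l compNl -compA.
suff -> : ca_p A ∘ ca_im A = 0 by rewrite comp0r subr0.
by rewrite /ca_im compDr comp1r compNr compA ca_pe comp1l subrr.
Qed.

Lemma ca_splittings (C : braided_additive) :
  idempotents_split C -> inhabited (forall A : calg C, splitting (ca_im A)).
Proof.
move=> split; constructor=> A.
suff /cid[x _] : exists x : splitting (ca_im A), True by [].
by have [x] := split _ _ (ca_im_idem A); exists x.
Qed.

Section Phi.
Variables (C : braided_additive) (C2 : two_invertible C).
(* An arbitrary choice of a splitting of 1 - e p for each composition algebra;
   such a choice exists by ca_splittings. *)
Variable s : forall A : calg C, splitting (ca_im A).

Definition ca_wedge (A : ca_data C) : hom (ca_ob A ⊗ ca_ob A) (ca_ob A) :=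
  half C2 (ca_mul A - ca_mul A ∘ braid (ca_ob A) (ca_ob A)).

Definition Phi_data (A : calg C) : vpa_data C :=
  let q := spl_q (s A) in let i := spl_i (s A) in
  {| vpa_ob := spl_ob (s A);
     vpa_cup := ca_cup A ∘ (i ⊠ i);
     vpa_cap := (q ⊠ q) ∘ ca_cap A;
     vpa_wedge := q ∘ ca_wedge A ∘ (i ⊠ i) |}.

Definition Phi_mor (A B : calg C) (f : hom (ca_ob A) (ca_ob B)) :
    hom (vpa_ob (Phi_data A)) (vpa_ob (Phi_data B)) :=
  spl_q (s B) ∘ f ∘ spl_i (s A).

Lemma spl_q_e (A : calg C) : spl_q (s A) ∘ ca_e A = 0.
Proof.
have qep : spl_q (s A) ∘ ca_e A ∘ ca_p A = 0.
  have := spl_qi (s A) => /(congr1 (fun g => g ∘ spl_q (s A))).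
  rewrite -compA spl_iq comp1l compDr comp1r compNr compA => /eqP.
  by rewrite addrC -subr_eq0 addrK oppr_eq0 => /eqP.
by rewrite -[LHS]comp1r -(ca_pe A) compA qep comp0l.
Qed.

Lemma Phi_mor1 (A : calg C) :
  Phi_mor (id1 (ca_ob A)) = id1 (vpa_ob (Phi_data A)).
Proof. by rewrite /Phi_mor comp1r spl_qi. Qed.

Lemma Phi_morM (A B D : calg C) (g : ca_hom B D) (f : ca_hom A B) :
  Phi_mor (ca_hom_val g ∘ ca_hom_val f)
  = Phi_mor (ca_hom_val g) ∘ Phi_mor (ca_hom_val f).
Proof.
rewrite /Phi_mor !compA -(compA _ (spl_i (s B))) spl_iq.
rewrite compDr comp1r compNr !compDl !compNl !compA.
rewrite -(compA _ (ca_hom_val g) (ca_e B)).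
by rewrite (ca_mor_e (ca_homP g)) spl_q_e !comp0l oppr0 addr0.
Qed.

Definition Phi
    (Phi_dataP : forall A : calg C, is_vpa (Phi_data A))
    (Phi_morP : forall (A B : calg C) (f : ca_hom A B),
       is_vpa_mor (Phi_data A) (Phi_data B) (Phi_mor (ca_hom_val f))) :
  functor (CA C) (VPA C).
Proof.
exists (fun A : CA C => VPAlg (Phi_dataP A) : VPA C)
  (fun (A B : CA C) (f : mor A B) =>
     @VPAHom C (VPAlg (Phi_dataP A)) (VPAlg (Phi_dataP B)) _ (Phi_morP A B f)).
- by move=> A; apply: vpa_hom_inj; apply: Phi_mor1.
- by move=> A B D g f; apply: vpa_hom_inj; apply: Phi_morM.
Defined.

End Phi.

(* Main.v *)
From mathcomp Require Import all_boot all_algebra.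
From mathcomp Require Import boolp.
Require Import Defs.

Set Implicit Arguments.
Unset Strict Implicit.
Unset Printing Implicit Defensive.
Import GRing.Theory.
Local Open Scope ring_scope.
Local Open Scope cat_scope.

(**
Write f ⊗ Z for the whiskering of f. Replacing a bracketed word X by the functor
Z |-> X ⊗ Z, computed by tensoring with the letters one at a time, turns the
associators and unitors into identities, so that the axioms become identities
between composites of whiskered generators.

Let <x, y> be the pairing. In a composition algebra write
m = p ⊗ 1 + 1 ⊗ p - e cup + w. Inserting the identity e in each of the four slots
of axiom (d) gives three identities in three variables, which together say that
<w(x, y), z> = <x, w(y, z)> and that this form changes sign under both braidings
of neighbouring strands. Restricted to V in all four slots, axiom (d) becomes
(P + F) s2 (1 + s3) = 2 P, where P is <a, b><c, d>, F is <w(a, b), w(c, d)> and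
sk braids the strands k and k + 1. Composing with the invertible s1 s2 turns this
into axiom (3) paired with a fourth vector. As A = I + V, axiom (d) is equivalent
to its restrictions to e in some slot and to V in all slots, and the same
computation read backwards makes I + V a composition algebra.
*)

(** * A decision procedure for identities of abelian groups *)

Inductive zexp :=
  ZVar of nat | ZZero | ZAdd of zexp & zexp | ZOpp of zexp | ZMuln of zexp & nat.

Fixpoint zeval (V : zmodType) (env : seq V) e : V :=
  match e with
  | ZVar n => env`_n
  | ZZero => 0
  | ZAdd e1 e2 => zeval env e1 + zeval env e2
  | ZOpp e1 => - zeval env e1
  | ZMuln e1 n => zeval env e1 *+ n
  end.

Fixpoint zcoef e (i : nat) : int :=
  match e with
  | ZVar n => (n == i)%:Z
  | ZZero => 0
  | ZAdd e1 e2 => zcoef e1 i + zcoef e2 i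
  | ZOpp e1 => - zcoef e1 i
  | ZMuln e1 n => zcoef e1 i * n%:Z
  end.

(** Both sides are additive in [e], so only variables matter. A variable whose index is out of range
    takes the default value [0] of the lookup, and its coefficient vanishes at every [i] of the
    sum. *)
Lemma zevalE (V : zmodType) (env : seq V) e :
  zeval env e = \sum_(i < size env) env`_i *~ zcoef e i.
Proof.
elim: e => [n||e1 IH1 e2 IH2|e IH|e IH n] /=.
- case: (ltnP n (size env)) => [lt_n|le_n].
    rewrite (bigD1 (Ordinal lt_n)) //= eqxx big1 ?addr0 // => i ne.
    by rewrite eq_sym -val_eqE /= in ne; rewrite (negPf ne).
  rewrite nth_default // big1 // => i _.
  by rewrite eqn_leq leqNgt (leq_trans (ltn_ord i) le_n).
- by rewrite big1.
- by rewrite IH1 IH2 -big_split; apply: eq_bigr => i _; rewrite mulrzDr.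
- by rewrite IH -sumrN; apply: eq_bigr => i _; rewrite mulrNz.
- by rewrite IH -sumrMnl; apply: eq_bigr => i _; rewrite pmulrn mulrzA.
Qed.

Definition zcheck n e1 e2 := all (fun i => zcoef e1 i == zcoef e2 i) (iota 0 n).

Lemma zcheckP (V : zmodType) (env : seq V) e1 e2 :
  zcheck (size env) e1 e2 -> zeval env e1 = zeval env e2.
Proof.
move=> /allP H; rewrite !zevalE; apply: eq_bigr => i _.
by rewrite (eqP (H i _)) // mem_iota add0n ltn_ord.
Qed.

(** Derives an equation from a known one [l = r]; the side condition left over is a plain abelian
    group identity, suited to [zmod]. *)
Lemma eq_lin (V : zmodType) (a b l r : V) : l = r -> a + r = b + l -> a = b.
Proof. by move=> -> /addIr. Qed.

Ltac zindex x env :=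
  match env with
  | x :: _ => constr:(O)
  | _ :: ?t => let n := zindex x t in constr:(S n)
  end.

Ltac zinsert x env :=
  match env with
  | context [x :: _] => env
  | _ => constr:(x :: env)
  end.

Ltac zatoms env x :=
  match x with
  | ?a + ?b => let env := zatoms env a in zatoms env b
  | - ?a => zatoms env a
  | ?a *+ _ => zatoms env a
  | 0 => env
  | _ => zinsert x env
  end.

Ltac zreify env x :=
  match x with
  | ?a + ?b => let u := zreify env a in let v := zreify env b in constr:(ZAdd u v)
  | - ?a => let u := zreify env a in constr:(ZOpp u)
  | ?a *+ ?n => let u := zreify env a in constr:(ZMuln u n)
  | 0 => constr:(ZZero)
  | _ => let n := zindex x env in constr:(ZVar n)
  end.

(** Subtraction is the sum with an opposite, so the reified grammar covers it. All other subterms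
    become atoms, and their integer coefficients are compared by computation. *)
Ltac zmod :=
  match goal with
  | |- @eq ?T ?l ?r =>
      let env := zatoms (@nil T) l in
      let env := zatoms env r in
      let u := zreify env l in
      let v := zreify env r in
      refine (@zcheckP _ env u v _); vm_compute; reflexivity
  end.


(** * Coherence *)

Section Words.
Variable C : braided_additive.
Implicit Types X Y Z : C.

Inductive word := Leaf of C | One | Tens of word & word.

Fixpoint wob w : C :=
  match w with Leaf X => X | One => 𝟙 | Tens a b => wob a ⊗ wob b end.

Fixpoint act w Z : C :=
  match w with Leaf X => X ⊗ Z | One => Z | Tens a b => act a (act b Z) end.

Fixpoint actm w Z Z' : hom Z Z' -> hom (act w Z) (act w Z') :=
  match w with
  | Leaf X => fun f => id1 X ⊠ f
  | One => fun f => f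
  | Tens a b => fun f => actm a (actm b f)
  end.

(** The canonical isomorphism that removes the brackets and units of [w]; [flatV] is its inverse. *)
Fixpoint flat w Z : hom (wob w ⊗ Z) (act w Z) :=
  match w with
  | Leaf X => id1 (X ⊗ Z)
  | One => lunit Z
  | Tens a b => flat a (act b Z) ∘ (id1 (wob a) ⊠ flat b Z) ∘ assoc _ _ _
  end.

Fixpoint flatV w Z : hom (act w Z) (wob w ⊗ Z) :=
  match w with
  | Leaf X => id1 (X ⊗ Z)
  | One => lunitV Z
  | Tens a b => assocV _ _ _ ∘ (id1 (wob a) ⊠ flatV b Z) ∘ flatV a (act b Z)
  end.

Lemma tens1M X Y Y' Y'' (g : hom Y' Y'') (f : hom Y Y') :
  id1 X ⊠ (g ∘ f) = (id1 X ⊠ g) ∘ (id1 X ⊠ f).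
Proof. by rewrite -tensmM comp1l. Qed.

Lemma tensM1 X Y Y' Y'' (g : hom Y' Y'') (f : hom Y Y') :
  (g ∘ f) ⊠ id1 X = (g ⊠ id1 X) ∘ (f ⊠ id1 X).
Proof. by rewrite -tensmM comp1l. Qed.

Lemma flatK w Z : flatV w Z ∘ flat w Z = id1 _.
Proof.
elim: w Z => [X|  |a IHa b IHb] Z /=; first by rewrite comp1l.
  exact: lunitK.
rewrite -!compA (compA (flatV a _)) IHa comp1l.
by rewrite (compA (id1 _ ⊠ _)) -tensmM IHb comp1l tensm1 comp1l assocK.
Qed.

Lemma flatVK w Z : flat w Z ∘ flatV w Z = id1 _.
Proof.
elim: w Z => [X|  |a IHa b IHb] Z /=; first by rewrite comp1l.
  exact: lunitVK.
rewrite -!compA (compA (assoc _ _ _)) assocVK comp1l.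
by rewrite (compA (id1 _ ⊠ _)) -tensmM IHb comp1l tensm1 comp1l IHa.
Qed.

Lemma flat_nat w Z Z' (f : hom Z Z') :
  actm w f ∘ flat w Z = flat w Z' ∘ (id1 (wob w) ⊠ f).
Proof.
elim: w Z Z' f => [X|  |a IHa b IHb] Z Z' f /=; first by rewrite comp1l comp1r.
  by rewrite lunit_nat.
by rewrite !compA IHa -!compA -tensm1 assoc_nat !compA -!(compA (flat a _)) -!tens1M IHb.
Qed.

Lemma actm1 w Z : actm w (id1 Z) = id1 _.
Proof. by elim: w Z => //= [X|a IHa b IHb] Z; rewrite ?tensm1 // IHb IHa. Qed.

Lemma actmM w Z Z' Z'' (g : hom Z' Z'') (f : hom Z Z') :
  actm w (g ∘ f) = actm w g ∘ actm w f.
Proof.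
elim: w Z Z' Z'' g f => //= [X|a IHa b IHb] Z Z' Z'' g f; rewrite ?tens1M //.
by rewrite IHb IHa.
Qed.

Fact sem_key : unit. Proof. by []. Qed.

(* Locked, since [compA] must not see the composite. *)
Definition sem (a b : word) (f : hom (wob a) (wob b)) Z :
    hom (act a Z) (act b Z) :=
  locked_with sem_key (flat b Z ∘ (f ⊠ id1 Z) ∘ flatV a Z).

Lemma semE a b (f : hom (wob a) (wob b)) Z :
  sem f Z = flat b Z ∘ (f ⊠ id1 Z) ∘ flatV a Z.
Proof. by rewrite /sem unlock. Qed.

Lemma sem_flat a b (f : hom (wob a) (wob b)) Z :
  sem f Z ∘ flat a Z = flat b Z ∘ (f ⊠ id1 Z).
Proof. by rewrite semE -!compA flatK comp1r. Qed.

(* [sem f Z] is the only solution of the equation [sem_flat]. *)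
Lemma sem_eq a b (f : hom (wob a) (wob b)) Z g :
  g ∘ flat a Z = flat b Z ∘ (f ⊠ id1 Z) -> sem f Z = g.
Proof. by move=> E; rewrite semE -E -compA flatVK comp1r. Qed.

(** Tensoring with [𝟙] is faithful, by naturality of the invertible [runit], so passing to whiskered
    form loses no information. *)
Lemma sem_inj a b (f g : hom (wob a) (wob b)) : sem f 𝟙 = sem g 𝟙 -> f = g.
Proof.
move=> E; have: f ⊠ id1 𝟙 = g ⊠ id1 𝟙.
  by rewrite -[LHS]comp1l -[RHS]comp1l -(flatK b) -!compA -!sem_flat E.
move=> {}E; rewrite -[f]comp1r -[g]comp1r -(runitVK (wob a)) !compA -!runit_nat.
by rewrite E.
Qed.

Lemma sem1 a Z : sem (a := a) (id1 _) Z = id1 _.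
Proof. by rewrite semE tensm1 comp1r flatVK. Qed.

Lemma semM a b c (g : hom (wob b) (wob c)) (f : hom (wob a) (wob b)) Z :
  sem (a := a) (b := c) (g ∘ f) Z = sem g Z ∘ sem f Z.
Proof. by apply: sem_eq; rewrite -compA sem_flat compA sem_flat tensM1 compA. Qed.

Lemma semD a b (f g : hom (wob a) (wob b)) Z : sem (f + g) Z = sem f Z + sem g Z.
Proof. by rewrite !semE tensmDl compDr compDl. Qed.

Lemma tens0m X X' Y Y' (g : hom Y Y') : (0 : hom X X') ⊠ g = 0.
Proof. by apply: (addrI ((0 : hom X X') ⊠ g)); rewrite -tensmDl !addr0. Qed.

Lemma tensm0 X X' Y Y' (f : hom X X') : f ⊠ (0 : hom Y Y') = 0.
Proof. by apply: (addrI (f ⊠ (0 : hom Y Y'))); rewrite -tensmDr !addr0. Qed.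

Lemma sem0 a b Z : sem (0 : hom (wob a) (wob b)) Z = 0.
Proof. by rewrite semE tens0m comp0r comp0l. Qed.

Lemma semN a b (f : hom (wob a) (wob b)) Z : sem (- f) Z = - sem f Z.
Proof. by apply/eqP; rewrite -addr_eq0 -semD addNr sem0. Qed.

(** The interchange law: [f] acts on the letters of the word and [g] on what stands to their
    right. *)
Lemma sem_nat a b (f : hom (wob a) (wob b)) Z Z' (g : hom Z Z') :
  sem f Z' ∘ actm a g = actm b g ∘ sem f Z.
Proof.
apply/esym; rewrite -[LHS]comp1r -[RHS]comp1r -(flatVK a) !compA.
congr (_ ∘ _); rewrite -!compA sem_flat flat_nat !compA flat_nat sem_flat -!compA.
by rewrite -!tensmM !comp1l !comp1r.
Qed.

(** This is the reason for the parameter [Z]: a factor standing to the right of [f] is absorbed into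
    it. *)
Lemma sem_whiskr a a' b (f : hom (wob a) (wob a')) Z :
  sem (a := Tens a b) (b := Tens a' b) (f ⊠ id1 (wob b)) Z = sem f (act b Z).
Proof.
apply: sem_eq; rewrite /= !compA sem_flat -!compA; congr (_ ∘ _).
by rewrite assoc_nat tensm1 !compA -!tensmM !comp1l !comp1r.
Qed.

Lemma sem_whiskl a b b' (f : hom (wob b) (wob b')) Z :
  sem (a := Tens a b) (b := Tens a b') (id1 (wob a) ⊠ f) Z = actm a (sem f Z).
Proof.
apply: sem_eq; rewrite /= !compA flat_nat -!compA; congr (_ ∘ _).
by rewrite assoc_nat !compA -!tens1M sem_flat.
Qed.

(** After naturality of the associator this is the pentagon; for [runit] the triangle plays the same
    role. *)
Lemma sem_assoc a b c Z :
  sem (a := Tens (Tens a b) c) (b := Tens a (Tens b c)) (assoc _ _ _) Z = id1 _.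
Proof.
apply: sem_eq; rewrite /= comp1l !tens1M -!compA; congr (_ ∘ (_ ∘ _)).
by rewrite [X in _ = _ ∘ X]compA -pentagon !compA -assoc_nat tensm1.
Qed.

Lemma sem_assocV a b c Z :
  sem (a := Tens a (Tens b c)) (b := Tens (Tens a b) c) (assocV _ _ _) Z = id1 _.
Proof.
have: sem (a := Tens (Tens a b) c) (b := Tens a (Tens b c)) (assoc _ _ _) Z
    ∘ sem (a := Tens a (Tens b c)) (b := Tens (Tens a b) c) (assocV _ _ _) Z
    = id1 _ by rewrite -semM assocVK (sem1 (Tens a (Tens b c))).
by rewrite sem_assoc comp1l.
Qed.

Lemma sem_runit a Z : sem (a := Tens a One) (b := a) (runit _) Z = id1 _.
Proof. by apply: sem_eq; rewrite /= comp1l -compA triangle. Qed.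

Lemma sem_runitV a Z : sem (a := a) (b := Tens a One) (runitV _) Z = id1 _.
Proof.
have: sem (a := Tens a One) (b := a) (runit _) Z
    ∘ sem (a := a) (b := Tens a One) (runitV _) Z = id1 _.
  by rewrite -semM runitVK sem1.
by rewrite sem_runit comp1l.
Qed.

(* [lunit] comes from the triangle for [𝟙 ⊗ (𝟙 ⊗ a)], by cancelling the left unit. *)
Lemma sem_lunit a Z : sem (a := Tens One a) (b := a) (lunit _) Z = id1 _.
Proof.
have inj b c (f g : hom (wob b) (wob c)) : id1 𝟙 ⊠ f = id1 𝟙 ⊠ g -> f = g.
  move=> E; rewrite -[f]comp1r -[g]comp1r -(lunitVK (wob b)) !compA -!lunit_nat.
  by rewrite E.
have L b Z' : sem (a := Tens One (Tens One b)) (b := Tens One b)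
    (id1 𝟙 ⊠ lunit _) Z' = id1 _.
  have := sem_assoc One One b Z'.
  move/(congr1 (fun f => sem (a := Tens One (Tens One b)) (b := Tens One b)
    (id1 𝟙 ⊠ lunit _) Z' ∘ f)).
  rewrite comp1r -semM triangle => <-.
  by rewrite (sem_whiskr (a := Tens One One) (a' := One)) (sem_runit One).
by have := L a Z; rewrite (sem_whiskl One (b := Tens One a) (b' := a)).
Qed.

Lemma sem_lunitV a Z : sem (a := a) (b := Tens One a) (lunitV _) Z = id1 _.
Proof.
have: sem (a := Tens One a) (b := a) (lunit _) Z
    ∘ sem (a := a) (b := Tens One a) (lunitV _) Z = id1 _.
  by rewrite -semM lunitVK sem1.
by rewrite sem_lunit comp1l.
Qed.

(** The hexagon, whose associators have become identities; [sem_braidl] is the other hexagon. *)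
Lemma sem_braidr a b c Z :
  sem (a := Tens a (Tens b c)) (b := Tens (Tens b c) a) (braid _ _) Z
  = actm b (sem (a := Tens a c) (b := Tens c a) (braid _ _) Z)
    ∘ sem (a := Tens a b) (b := Tens b a) (braid _ _) (act c Z).
Proof.
have := hexagon (wob a) (wob b) (wob c).
move/(congr1 (fun f => sem (a := Tens (Tens a b) c) (b := Tens b (Tens c a)) f Z)).
rewrite (semM (b := Tens a (Tens b c))) (semM (b := Tens (Tens b c) a)).
rewrite !sem_assoc comp1l comp1r => ->.
rewrite (semM (b := Tens (Tens b a) c)) (semM (b := Tens b (Tens a c))).
rewrite sem_assoc comp1r (sem_whiskr (a := Tens a b) (a' := Tens b a)).
by rewrite (sem_whiskl _ (b := Tens a c) (b' := Tens c a)).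
Qed.

Lemma sem_braidl a b c Z :
  sem (a := Tens (Tens a b) c) (b := Tens c (Tens a b)) (braid _ _) Z
  = sem (a := Tens a c) (b := Tens c a) (braid _ _) (act b Z)
    ∘ actm a (sem (a := Tens b c) (b := Tens c b) (braid _ _) Z).
Proof.
have := hexagonV (wob a) (wob b) (wob c).
move/(congr1 (fun f => sem (a := Tens a (Tens b c)) (b := Tens (Tens c a) b) f Z)).
rewrite (semM (b := Tens (Tens a b) c)) (semM (b := Tens c (Tens a b))).
rewrite !sem_assocV comp1l comp1r => ->.
rewrite (semM (b := Tens a (Tens c b))) (semM (b := Tens (Tens a c) b)).
rewrite sem_assocV comp1r (sem_whiskr (a := Tens a c) (a' := Tens c a)).
by rewrite (sem_whiskl _ (b := Tens b c) (b' := Tens c b)).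
Qed.

Lemma sem_braid_natl a b c (f : hom (wob a) (wob b)) Z :
  sem (a := Tens b c) (b := Tens c b) (braid _ _) Z ∘ sem f (act c Z)
  = actm c (sem f Z) ∘ sem (a := Tens a c) (b := Tens c a) (braid _ _) Z.
Proof.
rewrite -sem_whiskl -(sem_whiskr c).
rewrite -(semM (a := Tens a c) (b := Tens b c) (c := Tens c b)).
by rewrite -(semM (a := Tens a c) (b := Tens c a) (c := Tens c b)) braid_nat.
Qed.

Lemma sem_braid_natr a b c (f : hom (wob a) (wob b)) Z :
  sem (a := Tens c b) (b := Tens b c) (braid _ _) Z ∘ actm c (sem f Z)
  = sem f (act c Z) ∘ sem (a := Tens c a) (b := Tens a c) (braid _ _) Z.
Proof.
rewrite -sem_whiskl -(sem_whiskr c).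
rewrite -(semM (a := Tens c a) (b := Tens c b) (c := Tens b c)).
by rewrite -(semM (a := Tens c a) (b := Tens a c) (c := Tens b c)) braid_nat.
Qed.

(* The braiding with the unit is an invertible idempotent. *)
Lemma sem_braid1r a Z : sem (a := Tens a One) (b := Tens One a) (braid _ _) Z = id1 _.
Proof.
set b := sem _ _.
(* Naturality of the braiding along [lunit 𝟙], which acts as the identity; the hexagon splits the
   braiding with [𝟙 ⊗ 𝟙] into two copies of [b]. *)
have bb : b ∘ b = b.
  have := sem_braid_natr a (a := Tens One One) (b := One) (lunit 𝟙) Z.
  rewrite (sem_lunit One Z) (sem_lunit One (act a Z)) comp1l sem_braidr.
  by rewrite (actm1 a) comp1r => <-.
have : sem (a := Tens One a) (b := Tens a One) (braidV _ _) Z ∘ b = id1 _.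
  by rewrite -(semM (a := Tens a One) (b := Tens One a) (c := Tens a One)) braidK
    (sem1 (Tens a One)).
by move=> vb; rewrite -[LHS]comp1l -vb -compA bb vb.
Qed.

Lemma sem_braid1l a Z : sem (a := Tens One a) (b := Tens a One) (braid _ _) Z = id1 _.
Proof.
set b := sem _ _.
have bb : b ∘ b = b.
  have := sem_braid_natl a (a := Tens One One) (b := One) (lunit 𝟙) Z.
  rewrite (sem_lunit One (act a Z)) (sem_lunit One Z) comp1r sem_braidl.
  by rewrite (actm1 a) comp1l => <-.
have : sem (a := Tens a One) (b := Tens One a) (braidV _ _) Z ∘ b = id1 _.
  by rewrite -(semM (a := Tens One a) (b := Tens a One) (c := Tens One a)) braidK
    (sem1 (Tens One a)).
by move=> vb; rewrite -[LHS]comp1l -vb -compA bb vb.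
Qed.

End Words.

(** * Whiskered morphisms *)

Notation "X ◁ f" := (id1 X ⊠ f) (at level 37, right associativity) : cat_scope.
Notation "a ⊙ b" := (Tens a b) (at level 38, left associativity) : cat_scope.

(** From here on equations are stated after precomposition with an arbitrary [x], so that they
    rewrite anywhere inside a right-nested composite. This lemma returns to equations between
    morphisms. *)
Lemma comp_ext (P : preadditive) (X Y : P) (f g : hom X Y) :
  (forall W (x : hom W X), f ∘ x = g ∘ x) -> f = g.
Proof. by move=> /(_ _ (id1 X)); rewrite !comp1r. Qed.

Lemma sem_ext (C : braided_additive) (a b : word C) (f g : hom (wob a) (wob b)) :
  (forall Z W (x : hom W (act a Z)), sem f Z ∘ x = sem g Z ∘ x) -> f = g.
Proof. by move=> E; apply: sem_inj; apply: comp_ext. Qed.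

Lemma semK (C : braided_additive) (a b : word C)
    (f : hom (wob a) (wob b)) (g : hom (wob b) (wob a)) Z W (x : hom W _) :
  g ∘ f = id1 _ -> sem g Z ∘ (sem f Z ∘ x) = x.
Proof. by move=> E; rewrite compA -semM E (sem1 a) comp1l. Qed.

Section Whisker.
Variable C : braided_additive.
Implicit Types X Y Z W : C.

(* [hij f Z] is [f ⊗ Z], for [f] with [i] inputs and [j] outputs. *)
Definition h10 X (f : hom X 𝟙) Z : hom (X ⊗ Z) Z :=
  sem (a := Leaf X) (b := One C) f Z.
Definition h01 X (f : hom 𝟙 X) Z : hom Z (X ⊗ Z) :=
  sem (a := One C) (b := Leaf X) f Z.
Definition h11 X Y (f : hom X Y) Z : hom (X ⊗ Z) (Y ⊗ Z) :=
  sem (a := Leaf X) (b := Leaf Y) f Z.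
Definition h20 X Y (f : hom (X ⊗ Y) 𝟙) Z : hom (X ⊗ (Y ⊗ Z)) Z :=
  sem (a := Leaf X ⊙ Leaf Y) (b := One C) f Z.
Definition h02 X Y (f : hom 𝟙 (X ⊗ Y)) Z : hom Z (X ⊗ (Y ⊗ Z)) :=
  sem (a := One C) (b := Leaf X ⊙ Leaf Y) f Z.
Definition h21 X Y X' (f : hom (X ⊗ Y) X') Z : hom (X ⊗ (Y ⊗ Z)) (X' ⊗ Z) :=
  sem (a := Leaf X ⊙ Leaf Y) (b := Leaf X') f Z.
Definition h22 X Y X' Y' (f : hom (X ⊗ Y) (X' ⊗ Y')) Z :
    hom (X ⊗ (Y ⊗ Z)) (X' ⊗ (Y' ⊗ Z)) :=
  sem (a := Leaf X ⊙ Leaf Y) (b := Leaf X' ⊙ Leaf Y') f Z.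

Definition hbr X Y Z := h22 (braid X Y) Z.

Lemma h21D X Y X' (f g : hom (X ⊗ Y) X') Z : h21 (f + g) Z = h21 f Z + h21 g Z.
Proof. exact: (semD (a := Leaf X ⊙ Leaf Y) (b := Leaf X')). Qed.

(** This and the following lemmas are the interchange law, one instance for each number of inputs
    and outputs, with [actm] unfolded. *)
Lemma h10_nat X (f : hom X 𝟙) Z Z' (g : hom Z Z') W (x : hom W _) :
  h10 f Z' ∘ (X ◁ g ∘ x) = g ∘ (h10 f Z ∘ x).
Proof. by rewrite !compA (sem_nat (a := Leaf X) (b := One C) f g). Qed.

Lemma h01_nat X (f : hom 𝟙 X) Z Z' (g : hom Z Z') W (x : hom W _) :
  h01 f Z' ∘ (g ∘ x) = X ◁ g ∘ (h01 f Z ∘ x).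
Proof. by rewrite !compA (sem_nat (a := One C) (b := Leaf X) f g). Qed.

Lemma h11_nat X Y (f : hom X Y) Z Z' (g : hom Z Z') W (x : hom W _) :
  h11 f Z' ∘ (X ◁ g ∘ x) = Y ◁ g ∘ (h11 f Z ∘ x).
Proof. by rewrite !compA (sem_nat (a := Leaf X) (b := Leaf Y) f g). Qed.

Lemma h20_nat X Y (f : hom (X ⊗ Y) 𝟙) Z Z' (g : hom Z Z') W (x : hom W _) :
  h20 f Z' ∘ (X ◁ Y ◁ g ∘ x) = g ∘ (h20 f Z ∘ x).
Proof. by rewrite !compA (sem_nat (a := Leaf X ⊙ Leaf Y) (b := One C) f g). Qed.

Lemma h02_nat X Y (f : hom 𝟙 (X ⊗ Y)) Z Z' (g : hom Z Z') W (x : hom W _) :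
  h02 f Z' ∘ (g ∘ x) = X ◁ Y ◁ g ∘ (h02 f Z ∘ x).
Proof. by rewrite !compA (sem_nat (a := One C) (b := Leaf X ⊙ Leaf Y) f g). Qed.

Lemma h21_nat X Y X' (f : hom (X ⊗ Y) X') Z Z' (g : hom Z Z') W (x : hom W _) :
  h21 f Z' ∘ (X ◁ Y ◁ g ∘ x) = X' ◁ g ∘ (h21 f Z ∘ x).
Proof. by rewrite !compA (sem_nat (a := Leaf X ⊙ Leaf Y) (b := Leaf X') f g). Qed.

Lemma hbr_nat X Y Z Z' (g : hom Z Z') W (x : hom W _) :
  hbr X Y Z' ∘ (X ◁ Y ◁ g ∘ x) = Y ◁ X ◁ g ∘ (hbr X Y Z ∘ x).
Proof.
by rewrite !compA
  (sem_nat (a := Leaf X ⊙ Leaf Y) (b := Leaf Y ⊙ Leaf X) (braid X Y) g).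
Qed.

Lemma whM X Z Z' Z'' (g : hom Z' Z'') (f : hom Z Z') :
  X ◁ (g ∘ f) = X ◁ g ∘ X ◁ f.
Proof. exact: tens1M. Qed.

(** Applies a rewriting rule under [X ◁ _]. The premise ends in [id1 _] so that a rule stated with a
    test morphism can prove it. *)
Lemma wh2 X Z1 Z2 Z3 (f : hom Z2 Z3) (g : hom Z1 Z2) k :
  f ∘ (g ∘ id1 _) = k ∘ id1 _ ->
  forall W (x : hom W _), X ◁ f ∘ (X ◁ g ∘ x) = X ◁ k ∘ x.
Proof. by rewrite !comp1r => <- W x; rewrite whM !compA. Qed.

Lemma wh3 X Z1 Z2 Z3 Z4 (f : hom Z3 Z4) (g : hom Z2 Z3) (h : hom Z1 Z2) k :
  f ∘ (g ∘ (h ∘ id1 _)) = k ∘ id1 _ ->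
  forall W (x : hom W _), X ◁ f ∘ (X ◁ g ∘ (X ◁ h ∘ x)) = X ◁ k ∘ x.
Proof. by rewrite !comp1r => <- W x; rewrite !whM !compA. Qed.

Lemma whN X Z Z' (f : hom Z Z') : X ◁ (- f) = - (X ◁ f).
Proof. by apply/eqP; rewrite -addr_eq0 -tensmDr addNr tensm0. Qed.

(** Naturality of the braiding: [f] slides along the crossing strand, and the crossing disappears
    because the braiding with the unit is trivial. The next three lemmas are the variants. *)
Lemma hbr_10l X Y (f : hom X 𝟙) Z W (x : hom W _) :
  Y ◁ h10 f Z ∘ (hbr X Y Z ∘ x) = h10 f (Y ⊗ Z) ∘ x.
Proof.
have := sem_braid_natl (Leaf Y) (a := Leaf X) (b := One C) f Z.
rewrite sem_braid1l comp1l => E.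
by rewrite [RHS](congr1 (fun g => g ∘ x) E) !compA.
Qed.

Lemma hbr_10r X Y (f : hom X 𝟙) Z W (x : hom W _) :
  h10 f (Y ⊗ Z) ∘ (hbr Y X Z ∘ x) = Y ◁ h10 f Z ∘ x.
Proof.
have := sem_braid_natr (Leaf Y) (a := Leaf X) (b := One C) f Z.
rewrite sem_braid1r comp1l => E.
by rewrite [RHS](congr1 (fun g => g ∘ x) E) !compA.
Qed.

Lemma hbr_01l X Y (f : hom 𝟙 X) Z W (x : hom W _) :
  hbr X Y Z ∘ (h01 f (Y ⊗ Z) ∘ x) = Y ◁ h01 f Z ∘ x.
Proof.
have := sem_braid_natl (Leaf Y) (a := One C) (b := Leaf X) f Z.
rewrite sem_braid1l comp1r => E.
by rewrite compA [LHS](congr1 (fun g => g ∘ x) E).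
Qed.

Lemma hbr_01r X Y (f : hom 𝟙 X) Z W (x : hom W _) :
  hbr Y X Z ∘ (Y ◁ h01 f Z ∘ x) = h01 f (Y ⊗ Z) ∘ x.
Proof.
have := sem_braid_natr (Leaf Y) (a := One C) (b := Leaf X) f Z.
rewrite sem_braid1r comp1r => E.
by rewrite compA [LHS](congr1 (fun g => g ∘ x) E).
Qed.

Lemma hbr_11 X X' Y Y' (f : hom X X') (g : hom Y Y') Z W (x : hom W _) :
  hbr X' Y' Z ∘ (h11 f (Y' ⊗ Z) ∘ (X ◁ h11 g Z ∘ x))
  = h11 g (X' ⊗ Z) ∘ (Y ◁ h11 f Z ∘ (hbr X Y Z ∘ x)).
Proof.
have L U (y : hom U _) :
    hbr X' Y' Z ∘ (h11 f (Y' ⊗ Z) ∘ y) = Y' ◁ h11 f Z ∘ (hbr X Y' Z ∘ y).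
  have E := sem_braid_natl (Leaf Y') (a := Leaf X) (b := Leaf X') f Z.
  by rewrite compA [LHS](congr1 (fun g => g ∘ y) E) !compA.
have R U (y : hom U _) :
    hbr X Y' Z ∘ (X ◁ h11 g Z ∘ y) = h11 g (X ⊗ Z) ∘ (hbr X Y Z ∘ y).
  have E := sem_braid_natr (Leaf X) (a := Leaf Y) (b := Leaf Y') g Z.
  by rewrite compA [LHS](congr1 (fun g => g ∘ y) E) !compA.
by rewrite L R h11_nat.
Qed.

(** Again naturality, the hexagon having split the braiding with [X ⊗ X'] into two crossings. *)
Lemma hbr_20l X Y X' (f : hom (X ⊗ X') 𝟙) Z W (x : hom W _) :
  Y ◁ h20 f Z ∘ (hbr X Y (X' ⊗ Z) ∘ (X ◁ hbr X' Y Z ∘ x)) = h20 f (Y ⊗ Z) ∘ x.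
Proof.
have := sem_braid_natl (Leaf Y) (a := Leaf X ⊙ Leaf X') (b := One C) f Z.
rewrite sem_braid1l comp1l sem_braidl => E.
by rewrite [RHS](congr1 (fun g => g ∘ x) E) !compA.
Qed.

Lemma hbr_20r X Y X' (f : hom (X ⊗ X') 𝟙) Z W (x : hom W _) :
  h20 f (Y ⊗ Z) ∘ (X ◁ hbr Y X' Z ∘ (hbr Y X (X' ⊗ Z) ∘ x)) = Y ◁ h20 f Z ∘ x.
Proof.
have := sem_braid_natr (Leaf Y) (a := Leaf X ⊙ Leaf X') (b := One C) f Z.
rewrite sem_braid1r comp1l sem_braidr => E.
by rewrite [RHS](congr1 (fun g => g ∘ x) E) !compA.
Qed.

Lemma hbr_21l X Y X' V (f : hom (X ⊗ X') V) Z W (x : hom W _) :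
  hbr V Y Z ∘ (h21 f (Y ⊗ Z) ∘ x)
  = Y ◁ h21 f Z ∘ (hbr X Y (X' ⊗ Z) ∘ (X ◁ hbr X' Y Z ∘ x)).
Proof.
have := sem_braid_natl (Leaf Y) (a := Leaf X ⊙ Leaf X') (b := Leaf V) f Z.
rewrite sem_braidl => E.
by rewrite compA [LHS](congr1 (fun g => g ∘ x) E) !compA.
Qed.

Lemma hbr_21r X Y X' V (f : hom (X ⊗ X') V) Z W (x : hom W _) :
  hbr Y V Z ∘ (Y ◁ h21 f Z ∘ x)
  = h21 f (Y ⊗ Z) ∘ (X ◁ hbr Y X' Z ∘ (hbr Y X (X' ⊗ Z) ∘ x)).
Proof.
have := sem_braid_natr (Leaf Y) (a := Leaf X ⊙ Leaf X') (b := Leaf V) f Z.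
rewrite sem_braidr => E.
by rewrite compA [LHS](congr1 (fun g => g ∘ x) E) !compA.
Qed.

Lemma sem_tensm X X' Y Y' (f : hom X X') (g : hom Y Y') Z :
  h22 (f ⊠ g) Z = X' ◁ h11 g Z ∘ h11 f (Y ⊗ Z).
Proof.
rewrite /h22 -[f]comp1l -[g]comp1r tensmM.
rewrite (semM (b := Leaf X' ⊙ Leaf Y)) comp1l comp1r.
rewrite (sem_whiskl (Leaf X') (b := Leaf Y) (b' := Leaf Y')).
by rewrite (sem_whiskr (Leaf Y) (a := Leaf X) (a' := Leaf X')).
Qed.

Lemma h20_tensm X X' Y Y' (k : hom (X' ⊗ Y') 𝟙) (f : hom X X') (g : hom Y Y') Z :
  h20 (k ∘ (f ⊠ g)) Z = h20 k Z ∘ (X' ◁ h11 g Z ∘ h11 f (Y ⊗ Z)).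
Proof. by rewrite -sem_tensm /h20 (semM (b := Leaf X' ⊙ Leaf Y')). Qed.

Lemma h21_tensm X X' Y Y' T (k : hom (X' ⊗ Y') T) (f : hom X X') (g : hom Y Y') Z :
  h21 (k ∘ (f ⊠ g)) Z = h21 k Z ∘ (X' ◁ h11 g Z ∘ h11 f (Y ⊗ Z)).
Proof. by rewrite -sem_tensm /h21 (semM (b := Leaf X' ⊙ Leaf Y')). Qed.

Lemma h02_tensm X X' Y Y' (k : hom 𝟙 (X ⊗ Y)) (f : hom X X') (g : hom Y Y') Z :
  h02 ((f ⊠ g) ∘ k) Z = X' ◁ h11 g Z ∘ (h11 f (Y ⊗ Z) ∘ h02 k Z).
Proof. by rewrite compA -sem_tensm /h02 (semM (b := Leaf X ⊙ Leaf Y)). Qed.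

Lemma h21_comp X Y T T' (f : hom T T') (k : hom (X ⊗ Y) T) Z :
  h21 (f ∘ k) Z = h11 f Z ∘ h21 k Z.
Proof. by rewrite /h21 (semM (b := Leaf T)). Qed.

(** Invertibility of the braiding, in the form that replaces a test morphism by a braided one. *)
Lemma hbr_surj X Y Z W (x : hom W _) : exists y, hbr X Y Z ∘ y = x.
Proof.
exists (h22 (braidV X Y) Z ∘ x); rewrite compA.
rewrite -(semM (a := Leaf Y ⊙ Leaf X) (b := Leaf X ⊙ Leaf Y) (c := Leaf Y ⊙ Leaf X)).
by rewrite braidVK (sem1 (Leaf Y ⊙ Leaf X)) comp1l.
Qed.

Lemma wh_hbr_surj T X Y Z W (x : hom W _) : exists y, T ◁ hbr X Y Z ∘ y = x.
Proof.
have [y yP] := hbr_surj (X := X) (Y := Y) (Z := Z) (id1 _).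
by exists (T ◁ y ∘ x); rewrite compA -whM yP tensm1 comp1l.
Qed.

End Whisker.

(** * The double wedge axiom and the polarised norm identity *)

Section Polar.
Variables (C : braided_additive) (V : C).
Variables (cup : hom (V ⊗ V) 𝟙) (wedge : hom (V ⊗ V) V).

Local Notation u := (h20 cup).
Local Notation w := (h21 wedge).
Local Notation s := (hbr V V).

Hypothesis us : forall Z W (x : hom W _), u Z ∘ (s Z ∘ x) = u Z ∘ x.
Hypothesis ws : forall Z W (x : hom W _), w Z ∘ (s Z ∘ x) = - (w Z ∘ x).
Hypothesis cyc : forall Z W (x : hom W _),
  u Z ∘ (w (V ⊗ Z) ∘ (s (V ⊗ Z) ∘ (V ◁ s Z ∘ x))) = u Z ∘ (w (V ⊗ Z) ∘ x).

(** The form is invariant under the two crossings of [cyc] together. The crossing of the first two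
    strands is a sign by [ws], so that of the last two is a sign as well. *)
Lemma triple_s2 Z W (x : hom W _) :
  u Z ∘ (w (V ⊗ Z) ∘ (V ◁ s Z ∘ x)) = - (u Z ∘ (w (V ⊗ Z) ∘ x)).
Proof. by rewrite -(cyc x) ws compNr opprK. Qed.

(** Symmetry of the pairing carries [w] from the second argument to the first at the cost of two
    crossings, whose signs cancel. *)
Lemma triple_assoc Z W (x : hom W _) :
  u Z ∘ (V ◁ w Z ∘ x) = u Z ∘ (w (V ⊗ Z) ∘ x).
Proof.
rewrite -us hbr_21r triple_s2.
by rewrite ws compNr opprK.
Qed.

(** On four vectors, [P] is <a, b><c, d>, [N] is <a, d><b, c>, [F] is <w(a, b), w(c, d)>, [G] is
    <w(a, w(b, c)), d> and [H] is <w(w(a, b), c), d>. *)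
Let P Z W (x : hom W _) := u Z ∘ (u (V ⊗ (V ⊗ Z)) ∘ x).
Let N Z W (x : hom W _) := u Z ∘ (V ◁ u (V ⊗ Z) ∘ x).
Let F Z W (x : hom W _) := u Z ∘ (V ◁ w Z ∘ (w (V ⊗ (V ⊗ Z)) ∘ x)).
Let G Z W (x : hom W _) := u Z ∘ (w (V ⊗ Z) ∘ (V ◁ w (V ⊗ Z) ∘ x)).
Let H Z W (x : hom W _) := u Z ∘ (w (V ⊗ Z) ∘ (w (V ⊗ (V ⊗ Z)) ∘ x)).
Let s1 Z W (x : hom W _) := s (V ⊗ (V ⊗ Z)) ∘ x.
Let s2 Z W (x : hom W _) := V ◁ s (V ⊗ Z) ∘ x.
Let s3 Z W (x : hom W _) := V ◁ V ◁ s Z ∘ x.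

Let P1 Z W (x : hom W _) : P (s1 (Z := Z) x) = P x.
Proof. by rewrite /P /s1 us. Qed.

Let P21 Z W (x : hom W _) : P (s2 (Z := Z) (s1 x)) = N x.
Proof. by rewrite /P /s1 /s2 /N hbr_20r. Qed.

Let P23 Z W (x : hom W _) : P (s2 (Z := Z) (s3 x)) = N x.
Proof.
rewrite /P /s3 /s2 /N -(h20_nat cup (u Z)).
by rewrite (wh3 (k := u (V ⊗ Z))) // hbr_20l.
Qed.

Let N2 Z W (x : hom W _) : N (s2 (Z := Z) x) = N x.
Proof. by rewrite /N /s2 (wh2 (k := u (V ⊗ Z))) // us. Qed.

Let N12 Z W (x : hom W _) : N (s1 (Z := Z) (s2 x)) = P x.
Proof. by rewrite /N /s1 /s2 hbr_20l. Qed.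

(** The two crossings merge into a single crossing of the first strand with the value of a wedge;
    [triple_assoc] and antisymmetry then give the sign. *)
Let F21 Z W (x : hom W _) : F (s2 (Z := Z) (s1 x)) = - G x.
Proof. by rewrite /F /s1 /s2 /G -hbr_21r triple_assoc ws compNr. Qed.

Let F23 Z W (x : hom W _) : F (s2 (Z := Z) (s3 x)) = - G x.
Proof.
rewrite /F /s2 /s3 /G -h21_nat -triple_s2.
rewrite (wh3 (k := s Z ∘ w (V ⊗ Z))) ?whM -?compA //.
by rewrite hbr_21l.
Qed.

Let G2 Z W (x : hom W _) : G (s2 (Z := Z) x) = - G x.
Proof.
rewrite /G /s2 (wh2 (k := - w (V ⊗ Z))) ?whN ?compNl ?compNr //.
Qed.

Let G12 Z W (x : hom W _) : G (s1 (Z := Z) (s2 x)) = - H x.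
Proof. by rewrite /G /s1 /s2 /H -hbr_21l ws compNr. Qed.

(** The defect of [ca_comp] on four vectors when the product of two vectors is their wedge minus
    their pairing. *)
Definition polar Z W (x : hom W (V ⊗ (V ⊗ (V ⊗ (V ⊗ Z))))) :=
  P (s2 x) + F (s2 x) + P (s2 (s3 x)) + F (s2 (s3 x)) - P x *+ 2.

(** The defect of [vpa_double], with its value paired with a fourth vector. *)
Definition paired Z W (x : hom W (V ⊗ (V ⊗ (V ⊗ (V ⊗ Z))))) :=
  H x + G x - (P (s2 x) *+ 2 - P x - N x).

(** After [s2 s1], as after [s2 s3], [P] and [F] become [N] and [- G]. Absorbing the remaining [s2]
    gives [N] and [G], absorbing [s1 s2] gives [P] and [H]. *)
Lemma polar_paired Z W (x : hom W (V ⊗ (V ⊗ (V ⊗ (V ⊗ Z))))) :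
  polar (s1 (s2 x)) = paired x.
Proof.
by rewrite /polar P21 F21 P23 F23 N2 N12 G2 G12 P1 /paired; zmod.
Qed.

Lemma polar_eq0 :
  (forall Z W (x : hom W (V ⊗ (V ⊗ (V ⊗ (V ⊗ Z))))), polar x = 0) <->
  (forall Z W (x : hom W (V ⊗ (V ⊗ (V ⊗ (V ⊗ Z))))), paired x = 0).
Proof.
split=> E Z W x; first by rewrite -polar_paired.
(* The crossings are invertible, so every test morphism has the form [s1 (s2 z)]. *)
have [y <-] := hbr_surj (X := V) (Y := V) x.
have [z <-] := wh_hbr_surj (T := V) (X := V) (Y := V) y.
exact: etrans (polar_paired z) (E _ _ _).
Qed.

End Polar.

(** * The norm identity for three and four factors *)

Section Ternary.
Variables (C : braided_additive) (A : C).
Variables (cup : hom (A ⊗ A) 𝟙) (e : hom 𝟙 A) (p : hom A 𝟙).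
Variables (mul wedge : hom (A ⊗ A) A).

Local Notation u := (h20 cup).
Local Notation m := (h21 mul).
Local Notation w := (h21 wedge).
Local Notation s := (hbr A A).
Local Notation hp := (h10 p).
Local Notation he := (h01 e).

Hypothesis us : forall Z W (x : hom W _), u Z ∘ (s Z ∘ x) = u Z ∘ x.
Hypothesis uel : forall Z W (x : hom W _), u Z ∘ (he (A ⊗ Z) ∘ x) = hp Z ∘ x.
Hypothesis uer : forall Z W (x : hom W _), u Z ∘ (A ◁ he Z ∘ x) = hp Z ∘ x.
Hypothesis mE : forall Z, m Z = hp (A ⊗ Z) + A ◁ hp Z - he Z ∘ u Z + w Z.

(** On three elements these are p(a)<b, c>, p(b)<a, c> and <a, b>p(c). *)
Let p1u Z W (x : hom W _) := u Z ∘ (hp (A ⊗ (A ⊗ Z)) ∘ x).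
Let p2u Z W (x : hom W _) := u Z ∘ (A ◁ hp (A ⊗ Z) ∘ x).
Let up3 Z W (x : hom W _) := hp Z ∘ (u (A ⊗ Z) ∘ x).

Let mulE Z W (x : hom W _) :
  u Z ∘ (m (A ⊗ Z) ∘ x) = p1u x + p2u x - up3 x + u Z ∘ (w (A ⊗ Z) ∘ x).
Proof. by rewrite mE !compDl !compNl !compDr !compNr -compA uel. Qed.

Let mulE' Z W (x : hom W _) :
  u Z ∘ (A ◁ m Z ∘ x) = p2u x + up3 x - p1u x + u Z ∘ (A ◁ w Z ∘ x).
Proof.
rewrite mE !tensmDr whN whM !compDl !compNl !compDr !compNr -compA uer.
by rewrite h20_nat h10_nat.
Qed.

(** Crossing the last two strands fixes [p1u] and exchanges [p2u] with [up3]. So all scalar terms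
    cancel and only the wedge terms stay. *)
Lemma ternary12 Z W (x : hom W (A ⊗ (A ⊗ (A ⊗ Z)))) :
  u Z ∘ (m (A ⊗ Z) ∘ x) + u Z ∘ (m (A ⊗ Z) ∘ (A ◁ s Z ∘ x)) - p1u x *+ 2
  = u Z ∘ (w (A ⊗ Z) ∘ x) + u Z ∘ (w (A ⊗ Z) ∘ (A ◁ s Z ∘ x)).
Proof.
rewrite !mulE.
have -> : p1u (A ◁ s Z ∘ x) = p1u x by rewrite /p1u h10_nat us.
have -> : p2u (A ◁ s Z ∘ x) = up3 x.
  rewrite /p2u /up3 (wh2 (k := A ◁ hp Z)) ?h20_nat // => *.
  by rewrite hbr_10r.
have -> : up3 (A ◁ s Z ∘ x) = p2u x.
  rewrite /p2u /up3 -(h20_nat _ (hp Z)) (wh2 (k := hp (A ⊗ Z))) //.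
  by rewrite hbr_10l.
zmod.
Qed.

Lemma ternary23 Z W (x : hom W (A ⊗ (A ⊗ (A ⊗ Z)))) :
  u Z ∘ (m (A ⊗ Z) ∘ (A ◁ s Z ∘ x)) + u Z ∘ (A ◁ m Z ∘ x) - up3 x *+ 2
  = u Z ∘ (w (A ⊗ Z) ∘ (A ◁ s Z ∘ x)) + u Z ∘ (A ◁ w Z ∘ x).
Proof.
rewrite !mulE mulE'.
have -> : p1u (A ◁ s Z ∘ x) = p1u x by rewrite /p1u h10_nat us.
have -> : p2u (A ◁ s Z ∘ x) = up3 x.
  rewrite /p2u /up3 (wh2 (k := A ◁ hp Z)) ?h20_nat // => *.
  by rewrite hbr_10r.
have -> : up3 (A ◁ s Z ∘ x) = p2u x.
  rewrite /p2u /up3 -(h20_nat _ (hp Z)) (wh2 (k := hp (A ⊗ Z))) //.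
  by rewrite hbr_10l.
zmod.
Qed.

(** The same cancellation for the crossing of the first two strands, which exchanges [p1u] with
    [p2u] and fixes [up3]. *)
Lemma ternary13 Z W (x : hom W (A ⊗ (A ⊗ (A ⊗ Z)))) :
  u Z ∘ (A ◁ m Z ∘ (s (A ⊗ Z) ∘ x)) + u Z ∘ (m (A ⊗ Z) ∘ x) - p1u x *+ 2
  = u Z ∘ (A ◁ w Z ∘ (s (A ⊗ Z) ∘ x)) + u Z ∘ (w (A ⊗ Z) ∘ x).
Proof.
rewrite !mulE mulE'.
have -> : p1u (s (A ⊗ Z) ∘ x) = p2u x by rewrite /p1u hbr_10r.
have -> : p2u (s (A ⊗ Z) ∘ x) = p1u x by rewrite /p2u hbr_10l.
have -> : up3 (s (A ⊗ Z) ∘ x) = up3 x by rewrite /up3 us.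
zmod.
Qed.

End Ternary.

Section Quaternary.
Variables (C : braided_additive) (A : C).
Variables (cup : hom (A ⊗ A) 𝟙) (e : hom 𝟙 A) (p : hom A 𝟙).
Variables (mul : hom (A ⊗ A) A).

Local Notation u := (h20 cup).
Local Notation m := (h21 mul).
Local Notation s := (hbr A A).
Local Notation hp := (h10 p).
Local Notation he := (h01 e).

(** The difference of the two sides of [ca_comp] in whiskered form. *)
Definition quaternary Z W (x : hom W (A ⊗ (A ⊗ (A ⊗ (A ⊗ Z))))) :=
  u Z ∘ (A ◁ m Z ∘ (m (A ⊗ (A ⊗ Z)) ∘ (A ◁ s (A ⊗ Z) ∘ x)))
  + u Z ∘ (A ◁ m Z ∘ (m (A ⊗ (A ⊗ Z))
      ∘ (A ◁ s (A ⊗ Z) ∘ (A ◁ A ◁ s Z ∘ x))))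
  - (u Z ∘ (u (A ⊗ (A ⊗ Z)) ∘ x)) *+ 2.

Hypothesis us : forall Z W (x : hom W _), u Z ∘ (s Z ∘ x) = u Z ∘ x.
Hypothesis uel : forall Z W (x : hom W _), u Z ∘ (he (A ⊗ Z) ∘ x) = hp Z ∘ x.
Hypothesis uer : forall Z W (x : hom W _), u Z ∘ (A ◁ he Z ∘ x) = hp Z ∘ x.
Hypothesis m1l : forall Z W (x : hom W _), m Z ∘ (he (A ⊗ Z) ∘ x) = x.
Hypothesis m1r : forall Z W (x : hom W _), m Z ∘ (A ◁ he Z ∘ x) = x.

Let se1 Z W (x : hom W _) : A ◁ s Z ∘ (A ◁ he (A ⊗ Z) ∘ x) = A ◁ A ◁ he Z ∘ x.
Proof. by rewrite (wh2 (k := A ◁ he Z)) // hbr_01l. Qed.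

Let se2 Z W (x : hom W _) : A ◁ s Z ∘ (A ◁ A ◁ he Z ∘ x) = A ◁ he (A ⊗ Z) ∘ x.
Proof. by rewrite (wh2 (k := he (A ⊗ Z))) // hbr_01r. Qed.

Let m1r' Z W (x : hom W _) : A ◁ m Z ∘ (A ◁ A ◁ he Z ∘ x) = x.
Proof. by rewrite (wh2 (k := id1 _)) ?tensm1 ?comp1l. Qed.

Let m1l' Z W (x : hom W _) : A ◁ m Z ∘ (A ◁ he (A ⊗ Z) ∘ x) = x.
Proof. by rewrite (wh2 (k := id1 _)) ?tensm1 ?comp1l. Qed.

Lemma quaternary_e1 Z W (x : hom W (A ⊗ (A ⊗ (A ⊗ Z)))) :
  quaternary (he _ ∘ x)
  = u Z ∘ (A ◁ m Z ∘ (s (A ⊗ Z) ∘ x)) + u Z ∘ (m (A ⊗ Z) ∘ x)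
    - (u Z ∘ (hp (A ⊗ (A ⊗ Z)) ∘ x)) *+ 2.
Proof. by rewrite /quaternary -!h01_nat !m1l -hbr_21l us uel. Qed.

Lemma quaternary_e2 Z W (x : hom W (A ⊗ (A ⊗ (A ⊗ Z)))) :
  quaternary (A ◁ he _ ∘ x)
  = u Z ∘ (m (A ⊗ Z) ∘ x) + u Z ∘ (m (A ⊗ Z) ∘ (A ◁ s Z ∘ x))
    - (u Z ∘ (hp (A ⊗ (A ⊗ Z)) ∘ x)) *+ 2.
Proof.
have s3 : A ◁ A ◁ s Z ∘ (A ◁ he (A ⊗ (A ⊗ Z)) ∘ x)
    = A ◁ he (A ⊗ (A ⊗ Z)) ∘ (A ◁ s Z ∘ x).
  rewrite (wh2 (k := he (A ⊗ (A ⊗ Z)) ∘ s Z)) ?whM -?compA //.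
  by rewrite -h01_nat.
by rewrite /quaternary s3 !se1 !h21_nat !m1l' uer.
Qed.

(** Slots three and four yield the same condition, the two summands of the norm identity trading
    places. *)
Lemma quaternary_e3 Z W (x : hom W (A ⊗ (A ⊗ (A ⊗ Z)))) :
  quaternary (A ◁ A ◁ he _ ∘ x)
  = u Z ∘ (m (A ⊗ Z) ∘ (A ◁ s Z ∘ x)) + u Z ∘ (A ◁ m Z ∘ x)
    - (hp Z ∘ (u (A ⊗ Z) ∘ x)) *+ 2.
Proof.
have s3 : A ◁ A ◁ s Z ∘ (A ◁ A ◁ he (A ⊗ Z) ∘ x) = A ◁ A ◁ A ◁ he Z ∘ x.
  by rewrite (wh2 (k := A ◁ A ◁ he Z)) // comp1r -[LHS]comp1r -compA se1 comp1r.
have s2 : A ◁ s (A ⊗ Z) ∘ (A ◁ A ◁ A ◁ he Z ∘ x) = A ◁ A ◁ A ◁ he Z ∘ (A ◁ s Z ∘ x).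
  rewrite (wh2 (k := A ◁ A ◁ he Z ∘ s Z)) ?whM -?compA //.
  by rewrite hbr_nat.
rewrite /quaternary s3 s2 se2 m1r !h21_nat m1r' h20_nat uel.
by rewrite [X in X - _]addrC.
Qed.

Lemma quaternary_e4 Z W (x : hom W (A ⊗ (A ⊗ (A ⊗ Z)))) :
  quaternary (A ◁ A ◁ A ◁ he _ ∘ x)
  = u Z ∘ (m (A ⊗ Z) ∘ (A ◁ s Z ∘ x)) + u Z ∘ (A ◁ m Z ∘ x)
    - (hp Z ∘ (u (A ⊗ Z) ∘ x)) *+ 2.
Proof.
have s3 : A ◁ A ◁ s Z ∘ (A ◁ A ◁ A ◁ he Z ∘ x) = A ◁ A ◁ he (A ⊗ Z) ∘ x.
  by rewrite (wh2 (k := A ◁ he (A ⊗ Z))) // comp1r -[LHS]comp1r -compA se2 comp1r.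
have s2 : A ◁ s (A ⊗ Z) ∘ (A ◁ A ◁ A ◁ he Z ∘ x) = A ◁ A ◁ A ◁ he Z ∘ (A ◁ s Z ∘ x).
  rewrite (wh2 (k := A ◁ A ◁ he Z ∘ s Z)) ?whM -?compA //.
  by rewrite hbr_nat.
by rewrite /quaternary s3 s2 se2 m1r !h21_nat m1r' h20_nat uer.
Qed.

End Quaternary.

(** * The norm identity along a decomposition of [A] into scalars and vectors *)

Section Restriction.
Variables (C : braided_additive) (A V : C).
Variables (cup : hom (A ⊗ A) 𝟙) (e : hom 𝟙 A) (p : hom A 𝟙).
Variables (mul : hom (A ⊗ A) A).
Variables (i : hom V A) (q : hom A V).
Variables (cupV : hom (V ⊗ V) 𝟙) (wedge : hom (V ⊗ V) V).

Local Notation u := (h20 cup).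
Local Notation m := (h21 mul).
Local Notation s := (hbr A A).
Local Notation hp := (h10 p).
Local Notation he := (h01 e).
Local Notation hi := (h11 i).
Local Notation hq := (h11 q).
Local Notation uV := (h20 cupV).
Local Notation w := (h21 wedge).
Local Notation sV := (hbr V V).

Hypothesis splitx : forall Z W (x : hom W _),
  he Z ∘ (hp Z ∘ x) + hi Z ∘ (hq Z ∘ x) = x.

Lemma split_eq0 Z Z' (f : hom (A ⊗ Z) Z') :
  f ∘ he Z = 0 -> f ∘ hi Z = 0 -> f = 0.
Proof.
move=> fe fi; rewrite -[f]comp1r -(splitx (id1 _)) compDr !(compA f) fe fi.
by rewrite !comp0l addr0.
Qed.

Lemma wh_split_eq0 X Z Z' (f : hom (X ⊗ (A ⊗ Z)) Z') :
  f ∘ (X ◁ he Z) = 0 -> f ∘ (X ◁ hi Z) = 0 -> f = 0.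
Proof.
move=> fe fi; rewrite -[f]comp1r -tensm1 -(splitx (id1 _)) tensmDr !whM compDr.
by rewrite !(compA f) fe fi !comp0l addr0.
Qed.

Lemma wh2_split_eq0 X Y Z Z' (f : hom (X ⊗ (Y ⊗ (A ⊗ Z))) Z') :
  f ∘ (X ◁ Y ◁ he Z) = 0 -> f ∘ (X ◁ Y ◁ hi Z) = 0 -> f = 0.
Proof.
move=> fe fi; rewrite -[f]comp1r -2!tensm1 -(splitx (id1 _)) !tensmDr !whM compDr.
by rewrite !(compA f) fe fi !comp0l addr0.
Qed.

Lemma wh3_split_eq0 X Y T Z Z' (f : hom (X ⊗ (Y ⊗ (T ⊗ (A ⊗ Z)))) Z') :
  f ∘ (X ◁ Y ◁ T ◁ he Z) = 0 -> f ∘ (X ◁ Y ◁ T ◁ hi Z) = 0 -> f = 0.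
Proof.
move=> fe fi; rewrite -[f]comp1r -3!tensm1 -(splitx (id1 _)) !tensmDr !whM compDr.
by rewrite !(compA f) fe fi !comp0l addr0.
Qed.

Definition incl4 Z W (x : hom W (V ⊗ (V ⊗ (V ⊗ (V ⊗ Z))))) :=
  A ◁ A ◁ A ◁ hi Z ∘ (A ◁ A ◁ hi (V ⊗ Z)
    ∘ (A ◁ hi (V ⊗ (V ⊗ Z)) ∘ (hi (V ⊗ (V ⊗ (V ⊗ Z))) ∘ x))).

(** The slots are split from the last to the first. Once a slot carries [e], the corresponding
    hypothesis settles that branch, so only the branch with four vectors reaches the end. *)
Lemma quaternary_eq0 Z :
  quaternary cup mul (he (A ⊗ (A ⊗ (A ⊗ Z)))) = 0 ->
  quaternary cup mul (A ◁ he (A ⊗ (A ⊗ Z))) = 0 ->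
  quaternary cup mul (A ◁ A ◁ he (A ⊗ Z)) = 0 ->
  quaternary cup mul (A ◁ A ◁ A ◁ he Z) = 0 ->
  quaternary cup mul (incl4 (Z := Z) (id1 _)) = 0 ->
  forall W (x : hom W (A ⊗ (A ⊗ (A ⊗ (A ⊗ Z))))), quaternary cup mul x = 0.
Proof.
set D := quaternary cup mul (id1 (A ⊗ (A ⊗ (A ⊗ (A ⊗ Z))))).
have DE W (x : hom W _) : quaternary cup mul x = D ∘ x.
  by rewrite /D /quaternary !comp1r !mulr2n !(compDl, compNl) -!compA.
(* Commutes [e] with the inclusions already placed in later slots, bringing it next to [D]. *)
have hne Z1 Z2 (g : hom Z1 Z2) : A ◁ g ∘ he Z1 = he Z2 ∘ g.
  by rewrite -[he _]comp1r -h01_nat !comp1r.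
rewrite !DE => D1 D2 D3 D4 D5 W x; rewrite DE.
suff -> : D = 0 by rewrite comp0l.
apply: (wh3_split_eq0 D4); apply: wh2_split_eq0.
  by rewrite -compA -!whM hne !whM compA D3 comp0l.
apply: wh_split_eq0.
  by rewrite -!compA -!whM hne compA hne !whM !compA D2 !comp0l.
apply: split_eq0; first by rewrite -!compA hne -!h01_nat compA D1 comp0l.
by move: D5; rewrite /incl4 !comp1r !compA.
Qed.

Hypothesis hphe : forall Z W (x : hom W _), hp Z ∘ (he Z ∘ x) = x.
Hypothesis hphi : forall Z W (x : hom W _), hp Z ∘ (hi Z ∘ x) = 0.
Hypothesis uel : forall Z W (x : hom W _), u Z ∘ (he (A ⊗ Z) ∘ x) = hp Z ∘ x.
Hypothesis uer : forall Z W (x : hom W _), u Z ∘ (A ◁ he Z ∘ x) = hp Z ∘ x.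
Hypothesis uii : forall Z W (x : hom W _),
  u Z ∘ (A ◁ hi Z ∘ (hi (V ⊗ Z) ∘ x)) = uV Z ∘ x.
Hypothesis mii : forall Z W (x : hom W _),
  m Z ∘ (A ◁ hi Z ∘ (hi (V ⊗ Z) ∘ x)) = hi Z ∘ (w Z ∘ x) - he Z ∘ (uV Z ∘ x).

Lemma hbr_incl Z W (x : hom W _) :
  s Z ∘ (A ◁ hi Z ∘ (hi (V ⊗ Z) ∘ x)) = A ◁ hi Z ∘ (hi (V ⊗ Z) ∘ (sV Z ∘ x)).
Proof. by rewrite -!h11_nat hbr_11. Qed.

Let incl4_s2 Z W (x : hom W (V ⊗ (V ⊗ (V ⊗ (V ⊗ Z))))) :
  A ◁ s (A ⊗ Z) ∘ incl4 x = incl4 (V ◁ sV (V ⊗ Z) ∘ x).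
Proof.
rewrite /incl4.
have /(congr1 (fun f => A ◁ f)) : s (A ⊗ Z) ∘ (A ◁ A ◁ hi Z
    ∘ (A ◁ hi (V ⊗ Z) ∘ (hi (V ⊗ (V ⊗ Z)) ∘ id1 _)))
  = A ◁ A ◁ hi Z ∘ (A ◁ hi (V ⊗ Z) ∘ (hi (V ⊗ (V ⊗ Z)) ∘ (sV (V ⊗ Z) ∘ id1 _))).
  by rewrite hbr_nat hbr_incl.
rewrite !comp1r !whM => /(congr1 (fun f => f ∘ (hi _ ∘ x))).
by rewrite -!compA => ->; rewrite h11_nat.
Qed.

Let incl4_s3 Z W (x : hom W (V ⊗ (V ⊗ (V ⊗ (V ⊗ Z))))) :
  A ◁ A ◁ s Z ∘ incl4 x = incl4 (V ◁ V ◁ sV Z ∘ x).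
Proof.
rewrite /incl4.
have /(congr1 (fun f => A ◁ A ◁ f)) : s Z ∘ (A ◁ hi Z ∘ (hi (V ⊗ Z) ∘ id1 _))
  = A ◁ hi Z ∘ (hi (V ⊗ Z) ∘ (sV Z ∘ id1 _)) by rewrite hbr_incl.
rewrite !comp1r !whM => /(congr1 (fun f => f ∘ (A ◁ hi _ ∘ (hi _ ∘ x)))).
rewrite -!compA => ->; congr (_ ∘ (_ ∘ _)); rewrite h11_nat.
rewrite (wh2 (k := hi _ ∘ V ◁ sV Z)) ?whM -?compA //.
by rewrite h11_nat.
Qed.

Let incl4_u Z W (x : hom W (V ⊗ (V ⊗ (V ⊗ (V ⊗ Z))))) :
  u Z ∘ (u (A ⊗ (A ⊗ Z)) ∘ incl4 x) = uV Z ∘ (uV (V ⊗ (V ⊗ Z)) ∘ x).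
Proof. by rewrite /incl4 !h20_nat !uii. Qed.

(** The cross terms vanish because [e] is orthogonal to the image of [i], and the product of the two
    scalar parts survives because [p e = 1]. *)
Let incl4_m Z W (x : hom W (V ⊗ (V ⊗ (V ⊗ (V ⊗ Z))))) :
  u Z ∘ (A ◁ m Z ∘ (m (A ⊗ (A ⊗ Z)) ∘ incl4 x))
  = uV Z ∘ (uV (V ⊗ (V ⊗ Z)) ∘ x) + uV Z ∘ (V ◁ w Z ∘ (w (V ⊗ (V ⊗ Z)) ∘ x)).
Proof.
rewrite /incl4 !h21_nat mii.
have E U (y : hom U _) : A ◁ m Z ∘ (A ◁ A ◁ hi Z ∘ (A ◁ hi (V ⊗ Z) ∘ y))
    = A ◁ hi Z ∘ (A ◁ w Z ∘ y) - A ◁ he Z ∘ (A ◁ uV Z ∘ y).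
  rewrite (wh3 (k := hi Z ∘ w Z - he Z ∘ uV Z)).
    by rewrite tensmDr whN !whM compDl compNl -!compA.
  by rewrite mii !comp1r.
rewrite !E !(compDr, compNr) !uer.
rewrite -!h01_nat -(h11_nat i (w Z)) uii !h10_nat uel !hphe !hphi !comp0r.
zmod.
Qed.

Lemma quaternary_incl4 Z W (x : hom W (V ⊗ (V ⊗ (V ⊗ (V ⊗ Z))))) :
  quaternary cup mul (incl4 x) = polar cupV wedge x.
Proof.
rewrite /quaternary /polar incl4_s3 !incl4_s2 !incl4_m incl4_u; zmod.
Qed.

End Restriction.

(** * The axioms in whiskered form *)

Section WhiskeredAxioms.
Variables (C : braided_additive) (A : C).
Variables (cup : hom (A ⊗ A) 𝟙) (cap : hom 𝟙 (A ⊗ A)).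
Variables (e : hom 𝟙 A) (mul : hom (A ⊗ A) A).

Local Notation u := (h20 cup).
Local Notation n := (h02 cap).
Local Notation m := (h21 mul).
Local Notation s := (hbr A A).
Local Notation he := (h01 e).
Local Notation a := (Leaf A).
Local Notation o := (One C).

Lemma sem_snakel Z : sem (a := a) (b := a)
    (lunit A ∘ (cup ⊠ id1 A) ∘ assocV A A A ∘ (id1 A ⊠ cap) ∘ runitV A) Z
  = u (A ⊗ Z) ∘ A ◁ n Z.
Proof.
rewrite (semM (b := a ⊙ o)) (sem_runitV a) comp1r.
rewrite (semM (b := a ⊙ (a ⊙ a))) (semM (b := a ⊙ a ⊙ a)) (sem_assocV a a a) comp1r.
rewrite (semM (b := o ⊙ a)) (sem_lunit a) comp1l.
by rewrite (sem_whiskr a (a := a ⊙ a) (a' := o)) (sem_whiskl a (b := o) (b' := a ⊙ a)).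
Qed.

Lemma sem_snaker Z : sem (a := a) (b := a)
    (runit A ∘ (id1 A ⊠ cup) ∘ assoc A A A ∘ (cap ⊠ id1 A) ∘ lunitV A) Z
  = A ◁ u Z ∘ n (A ⊗ Z).
Proof.
rewrite (semM (b := o ⊙ a)) (sem_lunitV a) comp1r.
rewrite (semM (b := a ⊙ a ⊙ a)) (semM (b := a ⊙ (a ⊙ a))) (sem_assoc a a a) comp1r.
rewrite (semM (b := a ⊙ o)) (sem_runit a) comp1l.
by rewrite (sem_whiskr a (a := o) (a' := a ⊙ a)) (sem_whiskl a (b := a ⊙ a) (b' := o)).
Qed.

Lemma sem_cup_sym Z : sem (a := a ⊙ a) (b := o) (cup ∘ braid A A) Z = u Z ∘ s Z.
Proof. exact: (semM (a := a ⊙ a) (b := a ⊙ a) (c := o)). Qed.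

Lemma sem_mul_braid Z : sem (a := a ⊙ a) (b := a) (mul ∘ braid A A) Z = m Z ∘ s Z.
Proof. exact: (semM (a := a ⊙ a) (b := a ⊙ a) (c := a)). Qed.

Lemma sem_mul1l Z :
  sem (a := a) (b := a) (mul ∘ (e ⊠ id1 A) ∘ lunitV A) Z = m Z ∘ he (A ⊗ Z).
Proof.
rewrite (semM (b := o ⊙ a)) (sem_lunitV a) comp1r (semM (b := a ⊙ a)).
by rewrite (sem_whiskr a (a := o) (a' := a)).
Qed.

Lemma sem_mul1r Z :
  sem (a := a) (b := a) (mul ∘ (id1 A ⊠ e) ∘ runitV A) Z = m Z ∘ A ◁ he Z.
Proof.
rewrite (semM (b := a ⊙ o)) (sem_runitV a) comp1r (semM (b := a ⊙ a)).
by rewrite (sem_whiskl a (b := o) (b' := a)).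
Qed.

Lemma sem_cup1r Z :
  h10 (cup ∘ (id1 A ⊠ e) ∘ runitV A) Z = u Z ∘ A ◁ he Z.
Proof.
rewrite /h10 (semM (b := a ⊙ o)) (sem_runitV a) comp1r (semM (b := a ⊙ a)).
by rewrite (sem_whiskl a (b := o) (b' := a)).
Qed.

Lemma sem_triple Z :
  sem (a := a ⊙ a ⊙ a) (b := o) (cup ∘ (mul ⊠ id1 A)) Z = u Z ∘ m (A ⊗ Z).
Proof.
by rewrite (semM (b := a ⊙ a)) (sem_whiskr a (a := a ⊙ a) (a' := a)).
Qed.

Lemma sem_triple_cyclic Z :
  sem (a := a ⊙ a ⊙ a) (b := o)
    (cup ∘ (mul ⊠ id1 A) ∘ assocV A A A ∘ braid (A ⊗ A) A) Z
  = u Z ∘ m (A ⊗ Z) ∘ (s (A ⊗ Z) ∘ A ◁ s Z).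
Proof.
rewrite (semM (b := a ⊙ (a ⊙ a))) (sem_braidl a a a).
by rewrite (semM (b := a ⊙ a ⊙ a)) (sem_assocV a a a) comp1r sem_triple.
Qed.

Lemma sem_double Z :
  sem (a := a ⊙ a ⊙ a) (b := a)
    (mul ∘ (mul ⊠ id1 A) + mul ∘ (id1 A ⊠ mul) ∘ assoc A A A) Z
  = m Z ∘ m (A ⊗ Z) + m Z ∘ A ◁ m Z.
Proof.
rewrite semD (semM (b := a ⊙ a)) (sem_whiskr a (a := a ⊙ a) (a' := a)).
rewrite (semM (b := a ⊙ (a ⊙ a))) (sem_assoc a a a) comp1r (semM (b := a ⊙ a)).
by rewrite (sem_whiskl a (b := a ⊙ a) (b' := a)).
Qed.

Lemma sem_double_cup Z :
  sem (a := a ⊙ a ⊙ a) (b := a)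
    ((lunit A ∘ (cup ⊠ id1 A) ∘ assocV A A A
        ∘ (id1 A ⊠ braid A A) ∘ assoc A A A) *+ 2
      - lunit A ∘ (cup ⊠ id1 A)
      - runit A ∘ (id1 A ⊠ cup) ∘ assoc A A A) Z
  = (u (A ⊗ Z) ∘ A ◁ s Z) *+ 2 - u (A ⊗ Z) - A ◁ u Z.
Proof.
rewrite !semD !semN !(semM (b := a ⊙ (a ⊙ a))) (sem_assoc a a a) !comp1r.
rewrite (semM (b := a ⊙ a ⊙ a)) (sem_assocV a a a) comp1r.
rewrite !(semM (b := o ⊙ a)) (sem_lunit a) !comp1l (semM (b := a ⊙ o)) (sem_runit a) comp1l.
rewrite !(sem_whiskr a (a := a ⊙ a) (a' := o)) (sem_whiskl a (b := a ⊙ a) (b' := a ⊙ a)).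
by rewrite (sem_whiskl a (b := a ⊙ a) (b' := o)) mulr2n.
Qed.

(** Links the polarised computation to the axiom: [paired] vanishes when [vpa_double] holds, and
    conversely once the pairing is nondegenerate. *)
Lemma pairedE Z W (x : hom W (A ⊗ (A ⊗ (A ⊗ (A ⊗ Z))))) :
  paired cup mul x
  = u Z ∘ (sem (a := a ⊙ a ⊙ a) (b := a)
      (mul ∘ (mul ⊠ id1 A) + mul ∘ (id1 A ⊠ mul) ∘ assoc A A A) (A ⊗ Z) ∘ x)
  - u Z ∘ (sem (a := a ⊙ a ⊙ a) (b := a)
      ((lunit A ∘ (cup ⊠ id1 A) ∘ assocV A A A
        ∘ (id1 A ⊠ braid A A) ∘ assoc A A A) *+ 2
      - lunit A ∘ (cup ⊠ id1 A)
      - runit A ∘ (id1 A ⊠ cup) ∘ assoc A A A) (A ⊗ Z) ∘ x).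
Proof.
rewrite sem_double sem_double_cup /paired !mulr2n.
rewrite !(compDl, compNl) !(compDr, compNr) -!compA; reflexivity.
Qed.

Lemma sem_norm Z :
  sem (a := (a ⊙ a) ⊙ (a ⊙ a)) (b := o) (cup ∘ (mul ⊠ mul)) Z
  = u Z ∘ (A ◁ m Z ∘ m (A ⊗ (A ⊗ Z))).
Proof.
(* Factors [mul ⊠ mul] as [(id1 A ⊠ mul) ∘ (mul ⊠ id1 _)], so that each factor is a whiskering. *)
rewrite (semM (b := a ⊙ a)) -[X in X ⊠ _]comp1l -[X in _ ⊠ X]comp1r tensmM.
rewrite (semM (b := a ⊙ (a ⊙ a))) (sem_whiskr (a ⊙ a) (a := a ⊙ a) (a' := a)).
by rewrite (sem_whiskl a (b := a ⊙ a) (b' := a)).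
Qed.

Lemma sem_braid_mid Z :
  sem (a := (a ⊙ a) ⊙ (a ⊙ a)) (b := (a ⊙ a) ⊙ (a ⊙ a)) (braid_mid A) Z
  = A ◁ s (A ⊗ Z).
Proof.
rewrite /braid_mid (semM (b := a ⊙ (a ⊙ (a ⊙ a)))) (sem_assoc a a (a ⊙ a)) comp1r.
rewrite (semM (b := a ⊙ (a ⊙ (a ⊙ a)))) (sem_assocV a a (a ⊙ a)) comp1l.
rewrite (sem_whiskl a (b := a ⊙ (a ⊙ a)) (b' := a ⊙ (a ⊙ a))).
rewrite (semM (b := a ⊙ a ⊙ a)) (sem_assocV a a a) comp1r.
rewrite (semM (b := a ⊙ a ⊙ a)) (sem_assoc a a a) comp1l.
by rewrite (sem_whiskr a (a := a ⊙ a) (a' := a ⊙ a)).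
Qed.

Lemma sem_braid_last Z :
  sem (a := (a ⊙ a) ⊙ (a ⊙ a)) (b := (a ⊙ a) ⊙ (a ⊙ a)) (braid_last A) Z
  = A ◁ s (A ⊗ Z) ∘ A ◁ A ◁ s Z.
Proof.
rewrite /braid_last (semM (b := a ⊙ (a ⊙ (a ⊙ a)))) (sem_assoc a a (a ⊙ a)) comp1r.
rewrite (semM (b := a ⊙ (a ⊙ (a ⊙ a)))) (sem_assocV a a (a ⊙ a)) comp1l.
rewrite (sem_whiskl a (b := a ⊙ (a ⊙ a)) (b' := a ⊙ (a ⊙ a))).
rewrite (semM (b := a ⊙ a ⊙ a)) (sem_assocV a a a) comp1r.
by rewrite (sem_braidl a a a) (actmM a).
Qed.

Lemma sem_cup2 Z :
  sem (a := (a ⊙ a) ⊙ (a ⊙ a)) (b := o) (runit 𝟙 ∘ (cup ⊠ cup)) Z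
  = u Z ∘ u (A ⊗ (A ⊗ Z)).
Proof.
rewrite (semM (b := o ⊙ o)) (sem_runit o) comp1l.
rewrite -[X in X ⊠ _]comp1l -[X in _ ⊠ X]comp1r tensmM.
rewrite (semM (b := o ⊙ (a ⊙ a))) (sem_whiskr (a ⊙ a) (a := a ⊙ a) (a' := o)).
by rewrite (sem_whiskl o (b := a ⊙ a) (b' := o)).
Qed.

End WhiskeredAxioms.

(* The product of scalars and vectors without its vector part. *)
Definition inner_mul (C : braided_additive) (A : C)
    (cup : hom (A ⊗ A) 𝟙) (e : hom 𝟙 A) (p : hom A 𝟙) : hom (A ⊗ A) A :=
  lunit A ∘ (p ⊠ id1 A) + runit A ∘ (id1 A ⊠ p) - e ∘ cup.

Lemma inner_mulE (C : braided_additive) (A : C)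
    (cup : hom (A ⊗ A) 𝟙) (e : hom 𝟙 A) (p : hom A 𝟙) Z :
  h21 (inner_mul cup e p) Z
  = h10 p (A ⊗ Z) + A ◁ h10 p Z - h01 e Z ∘ h20 cup Z.
Proof.
pose a := Leaf A; pose o := One C.
rewrite /h21 !semD semN (semM (b := o)) (semM (b := o ⊙ a)) (sem_lunit a) comp1l.
rewrite (sem_whiskr a (a := a) (a' := o)).
rewrite (semM (b := a ⊙ o)) (sem_runit a) comp1l.
by rewrite (sem_whiskl a (b := a) (b' := o)).
Qed.

Lemma inner_mul_braid (C : braided_additive) (A : C)
    (cup : hom (A ⊗ A) 𝟙) (e : hom 𝟙 A) (p : hom A 𝟙) :
  cup ∘ braid A A = cup -> inner_mul cup e p ∘ braid A A = inner_mul cup e p.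
Proof.
pose a := Leaf A => us; apply: (sem_ext (a := a ⊙ a) (b := a)) => Z W x.
rewrite sem_mul_braid -[sem _ _]/(h21 (inner_mul cup e p) Z) inner_mulE.
rewrite !compDl !compNl -!compA hbr_10r hbr_10l.
rewrite [_ ◁ _ ∘ x + _]addrC; congr (_ - h01 e Z ∘ _).
by rewrite compA -sem_cup_sym us.
Qed.

(** * The pairing and the product on the sum of scalars and vectors *)

Section Extension.
Variables (C : braided_additive) (A V : C).
Variables (e : hom 𝟙 A) (p : hom A 𝟙) (i : hom V A) (q : hom A V).
Variables (cup : hom (V ⊗ V) 𝟙) (wedge : hom (V ⊗ V) V).

Definition ext_cup : hom (A ⊗ A) 𝟙 := runit 𝟙 ∘ (p ⊠ p) + cup ∘ (q ⊠ q).

Definition ext_vec : hom (A ⊗ A) A := i ∘ wedge ∘ (q ⊠ q).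

(** This is (a + x)(b + y) = (ab - <x, y>) + (ay + bx + w(x, y)). The scalar ab arises twice in
    [inner_mul] from [p], and the scalar part of [ext_cup] removes one copy. *)
Definition ext_mul : hom (A ⊗ A) A := inner_mul ext_cup e p + ext_vec.

Lemma ext_cupE Z W (x : hom W _) :
  h20 ext_cup Z ∘ x = h10 p Z ∘ (h10 p (A ⊗ Z) ∘ x)
    + h20 cup Z ∘ (V ◁ h11 q Z ∘ (h11 q (A ⊗ Z) ∘ x)).
Proof.
pose a := Leaf A; pose o := One C.
rewrite /h20 semD compDl; congr (_ + _); last first.
  by rewrite [sem _ _]h20_tensm -!compA.
rewrite (semM (b := o ⊙ o)) (sem_runit o) comp1l.
rewrite -[X in X ⊠ _]comp1l -[X in _ ⊠ X]comp1r tensmM (semM (b := o ⊙ a)).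
rewrite (sem_whiskl o (b := a) (b' := o)) (sem_whiskr a (a := a) (a' := o)).
by rewrite -compA.
Qed.

Lemma ext_mulE Z : h21 ext_mul Z = h10 p (A ⊗ Z) + A ◁ h10 p Z
  - h01 e Z ∘ h20 ext_cup Z + h21 ext_vec Z.
Proof. by rewrite h21D inner_mulE. Qed.

End Extension.

(** * From composition algebras to vector product algebras *)

Section Dual.
Variables (C : braided_additive) (A : C).
Variables (cup : hom (A ⊗ A) 𝟙) (cap : hom 𝟙 (A ⊗ A)).

Lemma is_symmetric_self_dualityP :
  is_symmetric_self_duality cup cap <->
  [/\ forall Z W (x : hom W _),
        h20 cup (A ⊗ Z) ∘ (A ◁ h02 cap Z ∘ x) = x,
      forall Z W (x : hom W _),
        A ◁ h20 cup Z ∘ (h02 cap (A ⊗ Z) ∘ x) = x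
    & forall Z W (x : hom W _), h20 cup Z ∘ (hbr A A Z ∘ x) = h20 cup Z ∘ x].
Proof.
split=> [[l r c]|[l r c]]; split.
- by move=> Z W x; rewrite compA -sem_snakel l (sem1 (Leaf A)) comp1l.
- by move=> Z W x; rewrite compA -sem_snaker r (sem1 (Leaf A)) comp1l.
- by move=> Z W x; rewrite compA -sem_cup_sym c.
- apply: (sem_ext (a := Leaf A) (b := Leaf A)) => Z W x.
  by rewrite sem_snakel (sem1 (Leaf A)) comp1l -compA l.
- apply: (sem_ext (a := Leaf A) (b := Leaf A)) => Z W x.
  by rewrite sem_snaker (sem1 (Leaf A)) comp1l -compA r.
- apply: (sem_ext (a := Leaf A ⊙ Leaf A) (b := One C)) => Z W x.
  by rewrite sem_cup_sym -compA c.
Qed.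

Hypothesis dual : is_symmetric_self_duality cup cap.

(** A snake identity expresses [f] through its pairing with one end of [cap], so that pairing
    determines [f]. *)
Lemma cup_nondegenerate (b : word C) (f g : hom (wob b) A) :
  (forall Z W (x : hom W _),
     h20 cup Z ∘ (sem (b := Leaf A) f (A ⊗ Z) ∘ x)
     = h20 cup Z ∘ (sem (b := Leaf A) g (A ⊗ Z) ∘ x)) -> f = g.
Proof.
have [l _ _] := is_symmetric_self_dualityP.1 dual.
move=> E; apply: (sem_ext (b := Leaf A)) => Z W x.
rewrite -[LHS]l -[RHS]l.
have N (k : hom (wob b) A) : A ◁ h02 cap Z ∘ (sem (b := Leaf A) k Z ∘ x)
    = sem (b := Leaf A) k (A ⊗ (A ⊗ Z)) ∘ (actm b (h02 cap Z) ∘ x).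
  by rewrite !compA (sem_nat (b := Leaf A) k).
by rewrite !N E.
Qed.

End Dual.

(** * The vector part of a composition algebra *)

Section OfCA.
Variables (C : braided_additive) (C2 : two_invertible C).
Variables (D : ca_data C) (DP : is_ca D).
Variables (V : C) (q : hom (ca_ob D) V) (i : hom V (ca_ob D)).
Hypotheses (qi : q ∘ i = id1 V) (iq : i ∘ q = ca_im D).

Local Notation A := (ca_ob D).
Local Notation cup := (ca_cup D).
Local Notation e := (ca_e D).
Local Notation p := (ca_p D).
Local Notation u := (h20 (ca_cup D)).
Local Notation n := (h02 (ca_cap D)).
Local Notation m := (h21 (ca_mul D)).
Local Notation s := (hbr A A).
Local Notation hp := (h10 p).
Local Notation he := (h01 e).
Local Notation hi := (h11 i).
Local Notation hq := (h11 q).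

Lemma ca_us Z W (x : hom W _) : u Z ∘ (s Z ∘ x) = u Z ∘ x.
Proof. by have [_ _ ->] := (is_symmetric_self_dualityP _ _).1 (ca_dual DP). Qed.

Lemma ca_uer Z W (x : hom W _) : u Z ∘ (A ◁ he Z ∘ x) = hp Z ∘ x.
Proof. by rewrite /ca_p sem_cup1r compA. Qed.

Lemma ca_uel Z W (x : hom W _) : u Z ∘ (he (A ⊗ Z) ∘ x) = hp Z ∘ x.
Proof. by rewrite -hbr_01r ca_us ca_uer. Qed.

Lemma ca_m1l Z W (x : hom W _) : m Z ∘ (he (A ⊗ Z) ∘ x) = x.
Proof. by rewrite compA -sem_mul1l (ca_mul1l DP) (sem1 (Leaf A)) comp1l. Qed.

Lemma ca_m1r Z W (x : hom W _) : m Z ∘ (A ◁ he Z ∘ x) = x.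
Proof. by rewrite compA -sem_mul1r (ca_mul1r DP) (sem1 (Leaf A)) comp1l. Qed.

Lemma ca_hphe Z W (x : hom W _) : hp Z ∘ (he Z ∘ x) = x.
Proof. by apply: (semK (a := One C) (b := Leaf A)); apply: (ca_pe (CAlg DP)). Qed.

Lemma ca_quaternary Z W (x : hom W (A ⊗ (A ⊗ (A ⊗ (A ⊗ Z))))) :
  quaternary cup (ca_mul D) x = 0.
Proof.
set aa := Leaf A ⊙ Leaf A.
have := congr1 (fun f => sem (a := aa ⊙ aa) (b := One C) f Z ∘ x) (ca_comp DP).
rewrite /= mulr2n !semD (sem_cup2 cup) (semM (b := aa ⊙ aa)) (sem_braid_mid A).
rewrite (semM (b := aa ⊙ aa)) (sem_braid_last A) !sem_norm !compDl -!compA => E.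
by rewrite /quaternary E mulr2n subrr.
Qed.

(** The vector part of the product, defined without halving; [ca_wedgeE] identifies it with
    [ca_wedge]. *)
Definition ca_vec : hom (A ⊗ A) A := ca_mul D - inner_mul cup e p.

Local Notation w := (h21 ca_vec).

Lemma ca_mulE Z : m Z = hp (A ⊗ Z) + A ◁ hp Z - he Z ∘ u Z + w Z.
Proof. by rewrite -inner_mulE -h21D addrC subrK. Qed.

(** The norm identity with [e] in the second slot; the next two lemmas use the fourth and the first
    slot. *)
Let ca_ternary12 Z W (x : hom W (A ⊗ (A ⊗ (A ⊗ Z)))) :
  u Z ∘ (w (A ⊗ Z) ∘ x) + u Z ∘ (w (A ⊗ Z) ∘ (A ◁ s Z ∘ x)) = 0.
Proof.
rewrite -(ternary12 ca_us ca_uel ca_mulE).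
by rewrite -(quaternary_e2 ca_uer ca_m1l) ca_quaternary.
Qed.

Let ca_ternary23 Z W (x : hom W (A ⊗ (A ⊗ (A ⊗ Z)))) :
  u Z ∘ (w (A ⊗ Z) ∘ (A ◁ s Z ∘ x)) + u Z ∘ (A ◁ w Z ∘ x) = 0.
Proof.
rewrite -(ternary23 ca_us ca_uel ca_uer ca_mulE).
by rewrite -(quaternary_e4 ca_uer ca_m1r) ca_quaternary.
Qed.

Let ca_ternary13 Z W (x : hom W (A ⊗ (A ⊗ (A ⊗ Z)))) :
  u Z ∘ (A ◁ w Z ∘ (s (A ⊗ Z) ∘ x)) + u Z ∘ (w (A ⊗ Z) ∘ x) = 0.
Proof.
rewrite -(ternary13 ca_us ca_uel ca_uer ca_mulE).
by rewrite -(quaternary_e1 ca_us ca_uel ca_m1l) ca_quaternary.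
Qed.

Lemma ca_triple_s2 Z W (x : hom W _) :
  u Z ∘ (w (A ⊗ Z) ∘ (A ◁ s Z ∘ x)) = - (u Z ∘ (w (A ⊗ Z) ∘ x)).
Proof. by apply/eqP; rewrite -addr_eq0 addrC ca_ternary12. Qed.

(** By [ca_ternary23] and [ca_triple_s2], <x, w(y, z)> = <w(x, y), z>, which turns [ca_ternary13]
    into a sign under the first crossing. *)
Lemma ca_triple_s1 Z W (x : hom W _) :
  u Z ∘ (w (A ⊗ Z) ∘ (s (A ⊗ Z) ∘ x)) = - (u Z ∘ (w (A ⊗ Z) ∘ x)).
Proof.
apply/eqP; rewrite -addr_eq0 -[X in _ + X](addrK (u Z ∘ (A ◁ w Z ∘ (s (A ⊗ Z) ∘ x)))).
rewrite [X in _ + (X - _)]addrC ca_ternary13 sub0r.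
have := ca_ternary23 (s (A ⊗ Z) ∘ x); rewrite ca_triple_s2 addrC => /eqP.
by rewrite subr_eq0 => /eqP ->; rewrite subrr.
Qed.

Lemma ca_vec_anti : ca_vec ∘ braid A A = - ca_vec.
Proof.
apply: (cup_nondegenerate (b := Leaf A ⊙ Leaf A) (ca_dual DP)) => Z W x.
rewrite (semM (b := Leaf A ⊙ Leaf A)) semN -compA [LHS]ca_triple_s1.
by rewrite compNl compNr.
Qed.

Lemma ca_ws Z W (x : hom W _) : w Z ∘ (s Z ∘ x) = - (w Z ∘ x).
Proof. by rewrite compA -sem_mul_braid ca_vec_anti semN compNl. Qed.

(** The scalar part of the product already gives x e = p(x)e + x - p(x)e = x, so the unit law leaves
    nothing for [w]. *)
Lemma ca_wr Z W (x : hom W _) : w Z ∘ (A ◁ he Z ∘ x) = 0.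
Proof.
have := congr1 (fun f => f ∘ (A ◁ he Z ∘ x)) (ca_mulE Z).
rewrite !compDl compNl -!compA ca_m1r ca_uer h10_nat.
rewrite (wh2 (k := id1 _)) ?comp1l ?ca_hphe // tensm1 comp1l => E.
by apply: (eq_lin (esym E)); zmod.
Qed.

(** Here p(w(x, y)) = <w(x, y), e> = - <w(x, e), y> = 0, so [w] takes vectors as values. *)
Lemma ca_pw Z W (x : hom W _) : hp Z ∘ (w Z ∘ x) = 0.
Proof.
rewrite -ca_uer -h21_nat.
apply: oppr_inj; rewrite -ca_triple_s2.
rewrite (wh2 (k := he (A ⊗ Z))) ?ca_wr ?comp0r ?oppr0 //.
by rewrite hbr_01r.
Qed.

(** The inner part of the product is invariant under the braiding and [ca_vec] changes sign, so the
    commutator is twice [ca_vec]. *)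
Lemma ca_wedgeE : ca_wedge C2 D = ca_vec.
Proof.
have [k kK _] := C2 (A ⊗ A) A; apply: (can_inj kK); rewrite halfK.
have := ca_vec_anti.
rewrite {1}/ca_vec compDl compNl (inner_mul_braid _ _ (cup_sym (ca_dual DP))) => E.
by apply: (eq_lin (esym E)); rewrite /ca_vec; zmod.
Qed.

Let qi1 Z W (x : hom W _) : hq Z ∘ (hi Z ∘ x) = x.
Proof. exact: (semK (a := Leaf V) (b := Leaf A)). Qed.

Lemma ca_split Z W (x : hom W _) : he Z ∘ (hp Z ∘ x) + hi Z ∘ (hq Z ∘ x) = x.
Proof.
have : e ∘ p + i ∘ q = id1 A by rewrite iq /ca_im addrC subrK.
move/(congr1 (fun f => sem (a := Leaf A) (b := Leaf A) f Z ∘ x)).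
rewrite /= semD (semM (b := One C)) (semM (b := Leaf V)) (sem1 (Leaf A)) comp1l.
by rewrite compDl -!compA.
Qed.

Lemma ca_hphi Z W (x : hom W _) : hp Z ∘ (hi Z ∘ x) = 0.
Proof.
have := congr1 (fun f => hp Z ∘ f) (ca_split (hi Z ∘ x)).
by rewrite qi1 compDr ca_hphe => E; apply: (eq_lin E); zmod.
Qed.

Definition vec_cup := cup ∘ (i ⊠ i).
Definition vec_cap := (q ⊠ q) ∘ ca_cap D.
Definition vec_wedge := q ∘ ca_wedge C2 D ∘ (i ⊠ i).

Local Notation uV := (h20 vec_cup).
Local Notation nV := (h02 vec_cap).
Local Notation wV := (h21 vec_wedge).
Local Notation sV := (hbr V V).

Let uii Z W (x : hom W _) : u Z ∘ (A ◁ hi Z ∘ (hi (V ⊗ Z) ∘ x)) = uV Z ∘ x.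
Proof. by rewrite h20_tensm -!compA. Qed.

Let wii Z W (x : hom W _) :
  w Z ∘ (A ◁ hi Z ∘ (hi (V ⊗ Z) ∘ x)) = hi Z ∘ (wV Z ∘ x).
Proof.
rewrite h21_tensm h21_comp ca_wedgeE -!compA.
by rewrite -[LHS]ca_split ca_pw comp0r add0r.
Qed.

Let mii Z W (x : hom W _) :
  m Z ∘ (A ◁ hi Z ∘ (hi (V ⊗ Z) ∘ x)) = hi Z ∘ (wV Z ∘ x) - he Z ∘ (uV Z ∘ x).
Proof.
rewrite ca_mulE !compDl compNl -!compA uii wii h10_nat ca_hphi comp0r add0r.
rewrite (wh2 (k := 0)) ?tensm0 ?comp0l ?add0r 1?addrC //.
by rewrite ca_hphi.
Qed.

Let u_hi_hq Z W (x : hom W _) :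
  u Z ∘ (A ◁ hi Z ∘ (A ◁ hq Z ∘ x)) = u Z ∘ x - hp Z ∘ (A ◁ hp Z ∘ x).
Proof.
have /(congr1 (fun f => A ◁ f)) := ca_split (Z := Z) (id1 _).
rewrite !comp1r tensmDr !whM tensm1 => /(congr1 (fun f => u Z ∘ (f ∘ x))).
rewrite comp1l compDl compDr -!compA ca_uer => E.
by apply: (eq_lin E); zmod.
Qed.

Let uV_hq Z W (x : hom W _) :
  uV Z ∘ (hq (V ⊗ Z) ∘ x) = u Z ∘ (A ◁ hi Z ∘ x).
Proof.
rewrite -uii -[in RHS](ca_split x) !compDr -h01_nat ca_uel ca_hphi.
by rewrite add0r.
Qed.

Let hi_inj Z W (x y : hom W (V ⊗ Z)) : hi Z ∘ x = hi Z ∘ y -> x = y.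
Proof. by move=> E; rewrite -[x]qi1 E qi1. Qed.

(** The snake identities of [A] restrict because [i q] differs from the identity by [e p], and this
    correction is killed by [p i = 0]. *)
Lemma vec_dual : is_symmetric_self_duality vec_cup vec_cap.
Proof.
have [l r _] := (is_symmetric_self_dualityP _ _).1 (ca_dual DP).
apply/is_symmetric_self_dualityP; split=> Z W x.
- rewrite h02_tensm !whM -!compA -uii !h11_nat.
  rewrite (wh2 (k := A ◁ hq Z ∘ hi (A ⊗ Z))) ?whM -?compA.
    by rewrite h20_nat u_hi_hq l !h10_nat ca_hphi !comp0r subr0 qi1.
  by rewrite h11_nat.
- rewrite h02_tensm -!compA -!h11_nat.
  rewrite (wh2 (k := u Z ∘ A ◁ hi Z)) ?whM -?compA.
    by rewrite -h02_nat r qi1.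
  by rewrite uV_hq.
- by rewrite -!uii -hbr_incl ca_us.
Qed.

Let vec_ws Z W (x : hom W _) : wV Z ∘ (sV Z ∘ x) = - (wV Z ∘ x).
Proof. by apply: hi_inj; rewrite compNr -!wii -hbr_incl ca_ws. Qed.

Let vec_triple Z W (x : hom W _) :
  uV Z ∘ (wV (V ⊗ Z) ∘ x) = u Z ∘ (w (A ⊗ Z)
    ∘ (A ◁ A ◁ hi Z ∘ (A ◁ hi (V ⊗ Z) ∘ (hi (V ⊗ (V ⊗ Z)) ∘ x)))).
Proof. by rewrite -uii -wii h21_nat. Qed.

(** Each of the two crossings changes the sign of the form, the second one by restriction of
    [ca_triple_s2]. *)
Let vec_cyc Z W (x : hom W _) :
  uV Z ∘ (wV (V ⊗ Z) ∘ (sV (V ⊗ Z) ∘ (V ◁ sV Z ∘ x))) = uV Z ∘ (wV (V ⊗ Z) ∘ x).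
Proof.
rewrite vec_ws compNr vec_triple h11_nat.
have := @hbr_incl _ _ _ i Z _ (id1 _).
rewrite !comp1r => /(congr1 (fun f => A ◁ f)); rewrite !whM.
move=> /(congr1 (fun f => f ∘ (hi _ ∘ x))); rewrite -!compA => <-.
by rewrite ca_triple_s2 opprK -vec_triple.
Qed.

Lemma vec_vpa : is_vpa (VPAData vec_cup vec_cap vec_wedge).
Proof.
pose a := Leaf V.
split=> /=; first exact: vec_dual.
- apply: (sem_ext (a := a ⊙ a) (b := a)) => Z W x.
  by rewrite sem_mul_braid semN compNl -compA vec_ws.
- apply: (sem_ext (a := a ⊙ a ⊙ a) (b := One C)) => Z W x.
  by rewrite sem_triple_cyclic sem_triple -!compA vec_cyc.
(* The double wedge axiom is tested by pairing with a fourth vector, which makes it the norm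
   identity on four vectors. *)
apply: (cup_nondegenerate (b := a ⊙ a ⊙ a) vec_dual) => Z W x.
have [_ _ us] := (is_symmetric_self_dualityP _ _).1 vec_dual.
have polar0 Z' W' (y : hom W' (V ⊗ (V ⊗ (V ⊗ (V ⊗ Z'))))) :
    polar vec_cup vec_wedge y = 0.
  rewrite -(quaternary_incl4 ca_hphe ca_hphi ca_uel ca_uer uii mii).
  exact: ca_quaternary.
have := (polar_eq0 us vec_ws vec_cyc).1 polar0 Z W x.
by rewrite pairedE => /eqP; rewrite subr_eq0 => /eqP.
Qed.

Let ca_wl Z W (x : hom W _) : w Z ∘ (he (A ⊗ Z) ∘ x) = 0.
Proof. by rewrite -hbr_01r ca_ws ca_wr oppr0. Qed.

(** Since [ca_vec] vanishes on [e] in both slots and takes vectors as values, it is determined by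
    its restriction to vectors. *)
Lemma ca_vecE : ca_vec = i ∘ vec_wedge ∘ (q ⊠ q).
Proof.
pose a := Leaf A; apply: (sem_ext (a := a ⊙ a) (b := a)) => Z W x.
rewrite -[in RHS]/(h21 _ _) h21_tensm h21_comp -!compA -wii.
rewrite -[in LHS](ca_split x) compDr ca_wl add0r.
rewrite h11_nat; move: (hi _ ∘ (hq _ ∘ x)) => y.
have /(congr1 (fun f => A ◁ f)) := ca_split (Z := Z) (id1 _).
rewrite !comp1r tensmDr !whM tensm1 => /(congr1 (fun f => w Z ∘ (f ∘ y))).
by rewrite comp1l compDl compDr -!compA ca_wr add0r.
Qed.

(** Together with [ca_cup_ext] this recovers the algebra from its vector product algebra, as
    fullness of the functor requires. *)
Lemma ca_mul_ext : ca_mul D = inner_mul cup e p + i ∘ vec_wedge ∘ (q ⊠ q).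
Proof. by rewrite -ca_vecE addrC subrK. Qed.

Lemma ca_cup_ext : cup = ext_cup p q vec_cup.
Proof.
pose a := Leaf A; apply: (sem_ext (a := a ⊙ a) (b := One C)) => Z W x.
rewrite -[RHS]/(h20 _ _ ∘ x) ext_cupE -uii h11_nat u_hi_hq.
rewrite [hp Z ∘ (A ◁ _ ∘ _)]h10_nat ca_hphi !comp0r subr0.
rewrite -ca_uel -compDr ca_split //.
Qed.

End OfCA.

(** * From vector product algebras to composition algebras *)

Section OfVPA.
Variables (C : braided_additive) (D : vpa_data C) (DP : is_vpa D).
Variable A : C.
Local Notation V := (vpa_ob D).
Variables (e : hom 𝟙 A) (p : hom A 𝟙) (i : hom V A) (q : hom A V).
Hypotheses (pe : p ∘ e = id1 𝟙) (qi : q ∘ i = id1 V).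
Hypotheses (pi : p ∘ i = 0) (qe : q ∘ e = 0) (epiq : e ∘ p + i ∘ q = id1 A).

Definition ext_cap : hom 𝟙 (A ⊗ A) :=
  (e ⊠ e) ∘ runitV 𝟙 + (i ⊠ i) ∘ vpa_cap D.

Definition ext_ca : ca_data C := {|
  ca_ob := A;
  ca_cup := ext_cup p q (vpa_cup D);
  ca_cap := ext_cap;
  ca_mul := ext_mul e p i q (vpa_cup D) (vpa_wedge D);
  ca_e := e |}.

Local Notation uV := (h20 (vpa_cup D)).
Local Notation nV := (h02 (vpa_cap D)).
Local Notation wV := (h21 (vpa_wedge D)).
Local Notation sV := (hbr V V).
Local Notation u := (h20 (ext_cup p q (vpa_cup D))).
Local Notation n := (h02 ext_cap).
Local Notation m := (h21 (ext_mul e p i q (vpa_cup D) (vpa_wedge D))).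
Local Notation s := (hbr A A).
Local Notation hp := (h10 p).
Local Notation he := (h01 e).
Local Notation hi := (h11 i).
Local Notation hq := (h11 q).
Local Notation w := (h21 (ext_vec i q (vpa_wedge D))).

Let hphe Z W (x : hom W _) : hp Z ∘ (he Z ∘ x) = x.
Proof. exact: (semK (a := One C) (b := Leaf A)). Qed.

Let hqhi Z W (x : hom W _) : hq Z ∘ (hi Z ∘ x) = x.
Proof. exact: (semK (a := Leaf V) (b := Leaf A)). Qed.

Let hphi Z W (x : hom W _) : hp Z ∘ (hi Z ∘ x) = 0.
Proof.
by rewrite compA -(semM (a := Leaf V) (b := Leaf A) (c := One C)) pi sem0 comp0l.
Qed.

Let hqhe Z W (x : hom W _) : hq Z ∘ (he Z ∘ x) = 0.
Proof.
by rewrite compA -(semM (a := One C) (b := Leaf A) (c := Leaf V)) qe sem0 comp0l.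
Qed.

Let split Z W (x : hom W _) : he Z ∘ (hp Z ∘ x) + hi Z ∘ (hq Z ∘ x) = x.
Proof.
move/(congr1 (fun f => sem (a := Leaf A) (b := Leaf A) f Z ∘ x)): epiq.
rewrite /= semD (semM (b := One C)) (semM (b := Leaf V)) (sem1 (Leaf A)) comp1l.
by rewrite compDl -!compA.
Qed.

Let vus Z W (x : hom W _) : uV Z ∘ (sV Z ∘ x) = uV Z ∘ x.
Proof. by have [_ _ ->] := (is_symmetric_self_dualityP _ _).1 (vpa_dual DP). Qed.

Let vws Z W (x : hom W _) : wV Z ∘ (sV Z ∘ x) = - (wV Z ∘ x).
Proof. by rewrite compA -sem_mul_braid (vpa_anti DP) semN compNl. Qed.

Let vcyc Z W (x : hom W _) :
  uV Z ∘ (wV (V ⊗ Z) ∘ (sV (V ⊗ Z) ∘ (V ◁ sV Z ∘ x))) = uV Z ∘ (wV (V ⊗ Z) ∘ x).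
Proof.
pose a := Leaf V.
have := congr1 (fun f => sem (a := a ⊙ a ⊙ a) (b := One C) f Z ∘ x) (vpa_cyclic DP).
by rewrite /= sem_triple sem_triple_cyclic -!compA.
Qed.

Let uE Z W (x : hom W _) : u Z ∘ x =
  hp Z ∘ (hp (A ⊗ Z) ∘ x) + uV Z ∘ (V ◁ hq Z ∘ (hq (A ⊗ Z) ∘ x)).
Proof. exact: ext_cupE. Qed.

Let mE Z : m Z = hp (A ⊗ Z) + A ◁ hp Z - he Z ∘ u Z + w Z.
Proof. exact: ext_mulE. Qed.

Let wE Z W (x : hom W _) :
  w Z ∘ x = hi Z ∘ (wV Z ∘ (V ◁ hq Z ∘ (hq (A ⊗ Z) ∘ x))).
Proof. by rewrite h21_tensm h21_comp -!compA. Qed.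

Let qs Z W (x : hom W _) :
  V ◁ hq Z ∘ (hq (A ⊗ Z) ∘ (s Z ∘ x)) = sV Z ∘ (V ◁ hq Z ∘ (hq (A ⊗ Z) ∘ x)).
Proof. by rewrite -!h11_nat hbr_11. Qed.

Let us Z W (x : hom W _) : u Z ∘ (s Z ∘ x) = u Z ∘ x.
Proof. by rewrite !uE hbr_10r h10_nat qs vus. Qed.

Let uel Z W (x : hom W _) : u Z ∘ (he (A ⊗ Z) ∘ x) = hp Z ∘ x.
Proof. by rewrite uE hphe hqhe !comp0r addr0. Qed.

Let uer Z W (x : hom W _) : u Z ∘ (A ◁ he Z ∘ x) = hp Z ∘ x.
Proof. by rewrite -us hbr_01r uel. Qed.

Let ws Z W (x : hom W _) : w Z ∘ (s Z ∘ x) = - (w Z ∘ x).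
Proof. by rewrite !wE qs vws compNr. Qed.

Let wl Z W (x : hom W _) : w Z ∘ (he (A ⊗ Z) ∘ x) = 0.
Proof. by rewrite wE hqhe !comp0r. Qed.

Let wr Z W (x : hom W _) : w Z ∘ (A ◁ he Z ∘ x) = 0.
Proof. by rewrite -[LHS]opprK -ws hbr_01r wl oppr0. Qed.

Let m1l Z W (x : hom W _) : m Z ∘ (he (A ⊗ Z) ∘ x) = x.
Proof.
by rewrite mE !compDl compNl -!compA uel hphe wl -h01_nat; zmod.
Qed.

Let m1r Z W (x : hom W _) : m Z ∘ (A ◁ he Z ∘ x) = x.
Proof.
rewrite mE !compDl compNl -!compA uer wr h10_nat.
rewrite (wh2 (k := id1 _)) ?comp1l ?hphe // tensm1 comp1l; zmod.
Qed.

Let uii Z W (x : hom W _) : u Z ∘ (A ◁ hi Z ∘ (hi (V ⊗ Z) ∘ x)) = uV Z ∘ x.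
Proof.
rewrite uE h10_nat hphi add0r !h11_nat hqhi.
by rewrite (wh2 (k := id1 _)) ?comp1l ?hqhi // tensm1 comp1l.
Qed.

Let wii Z W (x : hom W _) :
  w Z ∘ (A ◁ hi Z ∘ (hi (V ⊗ Z) ∘ x)) = hi Z ∘ (wV Z ∘ x).
Proof.
rewrite wE !h11_nat hqhi.
by rewrite (wh2 (k := id1 _)) ?comp1l ?hqhi // tensm1 comp1l.
Qed.

Let mii Z W (x : hom W _) :
  m Z ∘ (A ◁ hi Z ∘ (hi (V ⊗ Z) ∘ x)) = hi Z ∘ (wV Z ∘ x) - he Z ∘ (uV Z ∘ x).
Proof.
rewrite mE !compDl compNl -!compA uii wii h10_nat hphi comp0r add0r.
rewrite (wh2 (k := 0)) ?tensm0 ?comp0l ?add0r 1?addrC //.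
Qed.

Let u_hi Z W (x : hom W _) : u Z ∘ (A ◁ hi Z ∘ x) = uV Z ∘ (hq (V ⊗ Z) ∘ x).
Proof.
rewrite -[in LHS](split x) !compDr uii -h01_nat uel hphi.
by rewrite add0r.
Qed.

Let hi_u Z W (x : hom W _) : u Z ∘ (hi (A ⊗ Z) ∘ x) = uV Z ∘ (V ◁ hq Z ∘ x).
Proof. by rewrite uE hphi comp0r add0r hqhi. Qed.

Let nE Z : n Z = he (A ⊗ Z) ∘ he Z + A ◁ hi Z ∘ (hi (V ⊗ Z) ∘ nV Z).
Proof.
pose a := Leaf A; pose o := One C.
rewrite -h02_tensm /h02 [LHS]semD; congr (_ + _).
rewrite (semM (b := o ⊙ o)) (sem_runitV o) comp1r.
rewrite -[X in X ⊠ _]comp1r -[X in _ ⊠ X]comp1l tensmM (semM (b := o ⊙ a)).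
by rewrite (sem_whiskr a (a := o) (a' := a)) (sem_whiskl o (b := o) (b' := a)).
Qed.

Lemma ext_dual : is_symmetric_self_duality (ext_cup p q (vpa_cup D)) ext_cap.
Proof.
have [l r _] := (is_symmetric_self_dualityP _ _).1 (vpa_dual DP).
apply/is_symmetric_self_dualityP; split=> Z W x; last exact: us.
- rewrite nE tensmDr !whM !compDl !compDr -!compA uer h10_nat h20_nat u_hi.
  by rewrite h11_nat l split.
- rewrite nE !compDl !compDr -!compA -h01_nat uel.
  rewrite (wh2 (k := uV Z ∘ V ◁ hq Z)) ?whM -?compA.
    by rewrite -!h11_nat -h02_nat r split.
  by rewrite hi_u.
Qed.

Let triple Z W (x : hom W _) : u Z ∘ (w (A ⊗ Z) ∘ x)
  = uV Z ∘ (wV (V ⊗ Z) ∘ (V ◁ V ◁ hq Z ∘ (V ◁ hq (A ⊗ Z) ∘ (hq _ ∘ x)))).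
Proof. by rewrite wE hi_u h21_nat. Qed.

Let triple2 Z W (x : hom W _) :
  u Z ∘ (w (A ⊗ Z) ∘ (A ◁ s Z ∘ x)) = - (u Z ∘ (w (A ⊗ Z) ∘ x)).
Proof.
rewrite !triple h11_nat -(triple_s2 vws vcyc).
have := qs (Z := Z) (id1 _).
rewrite !comp1r => /(congr1 (fun f => V ◁ f)); rewrite !whM.
by move=> /(congr1 (fun f => f ∘ (hq _ ∘ x))); rewrite -!compA => ->.
Qed.

Let cyc Z W (x : hom W _) :
  u Z ∘ (w (A ⊗ Z) ∘ (s (A ⊗ Z) ∘ (A ◁ s Z ∘ x))) = u Z ∘ (w (A ⊗ Z) ∘ x).
Proof. by rewrite ws compNr triple2 opprK. Qed.

(** With [e] in some slot, everything reduces to signs of <w(x, y), z> under crossings; with four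
    vectors it is [vpa_double]. *)
Let ext_quaternary Z W (x : hom W (A ⊗ (A ⊗ (A ⊗ (A ⊗ Z))))) :
  quaternary (ext_cup p q (vpa_cup D)) (ext_mul e p i q (vpa_cup D) (vpa_wedge D)) x
  = 0.
Proof.
have t' := triple_assoc us ws cyc.
apply: (quaternary_eq0 split).
- rewrite -[he _]comp1r (quaternary_e1 us uel m1l) (ternary13 us uel uer mE).
  by rewrite t' ws compNr addNr.
- rewrite -[he _]comp1r whM (quaternary_e2 uer m1l) (ternary12 us uel mE).
  by rewrite triple2 subrr.
- rewrite -[he _]comp1r !whM (quaternary_e3 uel m1r) (ternary23 us uel uer mE).
  by rewrite t' triple2 addNr.
- rewrite -[he _]comp1r !whM (quaternary_e4 uer m1r) (ternary23 us uel uer mE).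
  by rewrite t' triple2 addNr.
rewrite (quaternary_incl4 hphe hphi uel uer uii mii).
apply: (polar_eq0 vus vws vcyc).2 => Z' W' y.
by rewrite pairedE (vpa_double DP) subrr.
Qed.

(** Hence the idempotent [ca_im] of the extended algebra is [1 - e p], which [q] and [i] split
    already. *)
Lemma ext_ca_p : ca_p ext_ca = p.
Proof.
apply: (sem_ext (a := Leaf A) (b := One C)) => Z W x.
by rewrite -[sem _ _]/(h10 _ _) sem_cup1r -compA uer.
Qed.

Lemma ext_is_ca : is_ca ext_ca.
Proof.
pose a := Leaf A; pose o := One C.
split=> /=; first exact: ext_dual.
- apply: (sem_ext (a := o) (b := o)) => Z W x.
  rewrite (semM (b := o ⊙ o)) (sem_runitV o) comp1r (semM (b := a ⊙ a)).
  rewrite -[X in X ⊠ _]comp1r -[X in _ ⊠ X]comp1l tensmM (semM (b := o ⊙ a)).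
  rewrite (sem_whiskr a (a := o) (a' := a)) (sem_whiskl o (b := o) (b' := a)).
  by rewrite -!compA [LHS]uel [LHS]hphe (sem1 o) comp1l.
- apply: (sem_ext (a := a ⊙ a) (b := a)) => Z W x.
  rewrite (semM (b := a ⊙ a)) sem_mul_braid -!compA.
  suff: m Z ∘ (s Z ∘ (s Z ∘ x)) = m Z ∘ x by [].
  (* The wedge term changes sign twice, the pairing term is fixed, and the two remaining terms are
     exchanged twice. *)
  rewrite mE !compDl !compNl -!compA !us !ws opprK.
  by rewrite !(hbr_10r, hbr_10l).
- apply: (sem_ext (a := a) (b := a)) => Z W x.
  by rewrite sem_mul1l -compA m1l (sem1 a) comp1l.
- apply: (sem_ext (a := a) (b := a)) => Z W x.
  by rewrite sem_mul1r -compA m1r (sem1 a) comp1l.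
apply: (sem_ext (a := (a ⊙ a) ⊙ (a ⊙ a)) (b := o)) => Z W x.
rewrite mulr2n !semD sem_cup2 (semM (b := (a ⊙ a) ⊙ (a ⊙ a))) sem_braid_mid.
rewrite (semM (b := (a ⊙ a) ⊙ (a ⊙ a))) sem_braid_last !sem_norm !compDl -!compA.
apply/eqP; rewrite -subr_eq0; apply/eqP; rewrite -[RHS](ext_quaternary x).
by rewrite /quaternary mulr2n.
Qed.

End OfVPA.

(** * The equivalence *)

(** Preimages of objects and morphisms are chosen by [cid]; faithfulness reduces the equations in
    [C] to their images under [F]. *)
Lemma fully_faithful_equivalence (C D : category) (F : functor C D) :
  (forall X Y (g : mor (F X) (F Y)), exists f, fmor F f = g) ->
  (forall X Y (f f' : mor X Y), fmor F f = fmor F f' -> f = f') ->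
  (forall Y : D, exists (X : C) (f : mor (F X) Y) (g : mor Y (F X)),
     compm g f = idm _ /\ compm f g = idm _) ->
  is_equivalence F.
Proof.
move=> full faithful surj.
pose ob Y := projT1 (cid (surj Y)).
have fP Y := projT2 (cid (surj Y)).
pose f Y : mor (F (ob Y)) Y := projT1 (cid (fP Y)).
have gP Y := projT2 (cid (fP Y)).
pose g Y : mor Y (F (ob Y)) := projT1 (cid (gP Y)).
have gf Y : compm (g Y) (f Y) = idm _ by have [] := projT2 (cid (gP Y)).
have fg Y : compm (f Y) (g Y) = idm _ by have [] := projT2 (cid (gP Y)).
pose lift X Y (h : mor (F X) (F Y)) := projT1 (cid (full X Y h)).
have liftK X Y (h : mor (F X) (F Y)) : fmor F (lift X Y h) = h.
  by rewrite /lift; case: cid.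
(* The quasi-inverse lifts the conjugate of [h] by the chosen isomorphisms. *)
pose Gm Y Y' (h : mor Y Y') := lift _ _ (compm (g Y') (compm h (f Y))).
have Gm1 Y : Gm Y Y (idm Y) = idm (ob Y).
  by apply: faithful; rewrite liftK compm1l gf fmor1.
have GmM Y1 Y2 Y3 (h : mor Y2 Y3) (k : mor Y1 Y2) :
    Gm _ _ (compm h k) = compm (Gm _ _ h) (Gm _ _ k).
  apply: faithful; rewrite fmorM !liftK -!compmA (compmA (f Y2)) fg compm1l.
  by rewrite !compmA.
exists (@Functor D C ob Gm Gm1 GmM); split; constructor.
  unshelve econstructor => /=.
  - by move=> X; apply: (lift _ _ (f (F X))).
  - by move=> X; apply: (lift _ _ (g (F X))).
  - move=> X Y h; apply: faithful; rewrite !fmorM !liftK.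
    by rewrite !compmA fg compm1l.
  - by move=> X; apply: faithful; rewrite fmorM !liftK gf fmor1.
  - by move=> X; apply: faithful; rewrite fmorM !liftK fg fmor1.
unshelve econstructor => /=.
- exact: f.
- exact: g.
- by move=> X Y h; rewrite liftK !compmA fg compm1l.
- exact: gf.
- exact: fg.
Qed.

Lemma runitV_nat (C : braided_additive) (X Y : C) (f : hom X Y) :
  (f ⊠ id1 𝟙) ∘ runitV X = runitV Y ∘ f.
Proof.
rewrite -[LHS]comp1l -(runitK Y) -!compA (compA (runit Y)) runit_nat -compA.
by rewrite runitVK comp1r.
Qed.

Lemma inner_mul_mor (C : braided_additive) (A B : C)
    (cup : hom (A ⊗ A) 𝟙) (e : hom 𝟙 A) (p : hom A 𝟙)
    (cup' : hom (B ⊗ B) 𝟙) (e' : hom 𝟙 B) (p' : hom B 𝟙) (f : hom A B) :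
  f ∘ e = e' -> p' ∘ f = p -> cup' ∘ (f ⊠ f) = cup ->
  inner_mul cup' e' p' ∘ (f ⊠ f) = f ∘ inner_mul cup e p.
Proof.
move=> fe fp fcup; rewrite /inner_mul !compDl compNl !compDr compNr -!compA fcup.
congr (_ + _ - _); last by rewrite compA fe.
  rewrite -tensmM fp comp1l (compA f) -lunit_nat -compA -tensmM.
  by rewrite comp1l comp1r.
rewrite -tensmM fp comp1l (compA f) -runit_nat -compA -tensmM.
by rewrite comp1l comp1r.
Qed.

(** * Morphisms that are the identity on scalars and a given [h] on vectors *)

Section ExtensionMorphism.
Variables (C : braided_additive) (A V B W : C).
Variables (e : hom 𝟙 A) (p : hom A 𝟙) (i : hom V A) (q : hom A V).
Variables (cup : hom (V ⊗ V) 𝟙) (wedge : hom (V ⊗ V) V).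
Variables (e' : hom 𝟙 B) (p' : hom B 𝟙) (i' : hom W B) (q' : hom B W).
Variables (cup' : hom (W ⊗ W) 𝟙) (wedge' : hom (W ⊗ W) W).
Variables (f : hom A B) (h : hom V W).
Hypotheses (fe : f ∘ e = e') (fp : p' ∘ f = p).
Hypotheses (fi : f ∘ i = i' ∘ h) (fq : q' ∘ f = h ∘ q).
Hypotheses (hcup : cup' ∘ (h ⊠ h) = cup) (hwedge : wedge' ∘ (h ⊠ h) = h ∘ wedge).

Lemma ext_cup_mor : ext_cup p' q' cup' ∘ (f ⊠ f) = ext_cup p q cup.
Proof. by rewrite /ext_cup compDl -!compA -!tensmM fp fq tensmM compA hcup. Qed.

Lemma ext_mul_mor :
  ext_mul e' p' i' q' cup' wedge' ∘ (f ⊠ f) = f ∘ ext_mul e p i q cup wedge.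
Proof.
rewrite /ext_mul compDl compDr; congr (_ + _); last first.
  rewrite /ext_vec -!compA -tensmM fq tensmM (compA wedge') hwedge !compA.
  by rewrite fi.
exact: (inner_mul_mor fe fp ext_cup_mor).
Qed.

End ExtensionMorphism.

Section Equivalence.
Variables (C : braided_additive) (C2 : two_invertible C).
Variable s : forall A : calg C, splitting (ca_im A).

Local Notation i A := (spl_i (s A)).
Local Notation q A := (spl_q (s A)).

Lemma Phi_data_vpa (A : calg C) : is_vpa (Phi_data C2 s A).
Proof. exact: (vec_vpa C2 (caP A) (spl_qi (s A)) (spl_iq (s A))). Qed.


Lemma ca_pi (A : calg C) : ca_p A ∘ i A = 0.
Proof.
rewrite -[LHS]comp1r -(spl_qi (s A)) compA -(compA _ (i A)) spl_iq.
by rewrite /ca_im compDr comp1r compNr compA ca_pe comp1l subrr comp0l.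
Qed.

Lemma ca_hom_p (A B : calg C) (f : ca_hom A B) : ca_p B ∘ ca_hom_val f = ca_p A.
Proof.
have [fc _ fe] := ca_homP f.
rewrite {1}/ca_p -compA -runitV_nat compA -(compA (ca_cup B)) -tensmM comp1l comp1r.
by rewrite -fe -[X in X ⊠ _]comp1r tensmM compA fc.
Qed.

(** A morphism preserves [p], so it carries vectors to vectors; dually, [Phi_mor_q] holds because it
    preserves [e]. *)
Lemma Phi_mor_i (A B : calg C) (f : ca_hom A B) :
  i B ∘ Phi_mor C2 s (ca_hom_val f) = ca_hom_val f ∘ i A.
Proof.
rewrite /Phi_mor !compA spl_iq /ca_im !compDl compNl comp1l -(compA (ca_e B)).
by rewrite ca_hom_p compNl -(compA (ca_e B)) ca_pi comp0r subr0.
Qed.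

Lemma Phi_mor_q (A B : calg C) (f : ca_hom A B) :
  Phi_mor C2 s (ca_hom_val f) ∘ q A = q B ∘ ca_hom_val f.
Proof.
rewrite /Phi_mor -!compA spl_iq /ca_im !compDr compNr comp1r (compA _ (ca_e A)).
by rewrite (ca_mor_e (ca_homP f)) compNr compA (spl_q_e s) comp0l subr0.
Qed.

Lemma ca_wedge_mor (A B : calg C) (f : ca_hom A B) :
  ca_wedge C2 B ∘ (ca_hom_val f ⊠ ca_hom_val f) = ca_hom_val f ∘ ca_wedge C2 A.
Proof.
have [k kK _] := C2 (ca_ob A ⊗ ca_ob A) (ca_ob B); apply: (can_inj kK).
rewrite !mulr2n -compDl -compDr -!mulr2n !halfK compDl compDr compNl compNr.
by rewrite -compA braid_nat !compA (ca_mor_mul (ca_homP f)).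
Qed.

Lemma Phi_mor_vpa (A B : calg C) (f : ca_hom A B) :
  is_vpa_mor (Phi_data C2 s A) (Phi_data C2 s B) (Phi_mor C2 s (ca_hom_val f)).
Proof.
have ii : (i B ⊠ i B) ∘ (Phi_mor C2 s (ca_hom_val f) ⊠ Phi_mor C2 s (ca_hom_val f))
    = (ca_hom_val f ⊠ ca_hom_val f) ∘ (i A ⊠ i A).
  by rewrite -!tensmM Phi_mor_i.
split=> /=; rewrite -compA ii compA.
  by rewrite (ca_mor_cup (ca_homP f)).
by rewrite -(compA (q B)) ca_wedge_mor compA -Phi_mor_q -!compA.
Qed.

Let PhiF := Phi Phi_data_vpa Phi_mor_vpa.

Let ca_epiq (A : calg C) : ca_e A ∘ ca_p A + i A ∘ q A = id1 _.
Proof. by rewrite spl_iq /ca_im addrC subrK. Qed.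

Lemma Phi_faithful (A B : CA C) (f g : mor A B) : fmor PhiF f = fmor PhiF g -> f = g.
Proof.
move=> E; apply: ca_hom_inj.
have {}E : Phi_mor C2 s (ca_hom_val f) = Phi_mor C2 s (ca_hom_val g).
  exact: (congr1 (fun h => vpa_hom_val h) E).
(* A morphism is determined by its values on [e], which are prescribed, and on vectors. *)
rewrite -[LHS]comp1r -[RHS]comp1r -ca_epiq !compDr !compA.
rewrite (ca_mor_e (ca_homP f)) (ca_mor_e (ca_homP g)).
by rewrite -!Phi_mor_i E.
Qed.

Lemma Phi_full (A B : CA C) (h : mor (PhiF A) (PhiF B)) : exists f, fmor PhiF f = h.
Proof.
case: h => h [/= hcup hwedge].
(* The extension of [h] by the identity on the unit summand. *)
pose f := ca_e B ∘ ca_p A + i B ∘ h ∘ q A.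
have fe : f ∘ ca_e A = ca_e B.
  by rewrite compDl -2!(compA _ _ (ca_e A)) ca_pe (spl_q_e s) comp0r comp1r addr0.
have fp : ca_p B ∘ f = ca_p A.
  by rewrite compDr !compA ca_pe ca_pi !comp0l comp1l addr0.
have fi : f ∘ i A = i B ∘ h.
  by rewrite compDl -2!(compA _ _ (i A)) ca_pi spl_qi comp0r add0r comp1r.
have fq : q B ∘ f = h ∘ q A.
  by rewrite compDr !compA (spl_q_e s) spl_qi !comp0l add0r comp1l.
have fP : is_ca_mor A B f.
  split=> //.
    rewrite (ca_cup_ext (caP A) (spl_qi (s A)) (spl_iq (s A))).
    rewrite (ca_cup_ext (caP B) (spl_qi (s B)) (spl_iq (s B))).
    exact: (ext_cup_mor fp fq hcup).
  rewrite (ca_mul_ext C2 (caP A) (spl_iq (s A))).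
  rewrite (ca_mul_ext C2 (caP B) (spl_iq (s B))).
  rewrite (ca_cup_ext (caP A) (spl_qi (s A)) (spl_iq (s A))).
  rewrite (ca_cup_ext (caP B) (spl_qi (s B)) (spl_iq (s B))).
  exact: (ext_mul_mor fe fp fi fq hcup hwedge).
exists (CAHom fP); apply: vpa_hom_inj => /=.
by rewrite /Phi_mor /= fq -compA spl_qi comp1r.
Qed.

Lemma Phi_essentially_surjective (sums : has_finite_direct_sums C) (V : VPA C) :
  exists (A : CA C) (f : mor (PhiF A) V) (g : mor V (PhiF A)),
    compm g f = idm _ /\ compm f g = idm _.
Proof.
(* The composition algebra lives on the direct sum of [𝟙] and the given object. *)
have [S [inj [prj [prjK prj0 sum1]]]] := sums 2
  (fun k : 'I_2 => if val k is 0 then 𝟙 else vpa_ob V).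
pose k0 : 'I_2 := ord0; pose k1 : 'I_2 := lift ord0 ord0.
pose e : hom 𝟙 S := inj k0; pose p : hom S 𝟙 := prj k0.
pose j : hom (vpa_ob V) S := inj k1; pose r : hom S (vpa_ob V) := prj k1.
have pe : p ∘ e = id1 𝟙 := prjK k0.
have rj : r ∘ j = id1 _ := prjK k1.
have pj : p ∘ j = 0 := prj0 k1 k0 isT.
have re : r ∘ e = 0 := prj0 k0 k1 isT.
have epjr : e ∘ p + j ∘ r = id1 S by rewrite -sum1 big_ord_recl big_ord1.
pose A := CAlg (ext_is_ca (vpaP V) pe rj pj re epjr).
have Ap : ca_p A = p := ext_ca_p (vpaP V) j pe re.
(* Two splittings of the same idempotent [1 - e p], hence isomorphic through [q A ∘ j] and
   [r ∘ i A]. *)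
have jr : j ∘ r = i A ∘ q A.
  by rewrite spl_iq /ca_im Ap; apply: (canRL (addrK _)); apply: etrans (addrC _ _) (epjr).
have Aw : ca_wedge C2 A = ext_vec j r (vpa_wedge V).
  rewrite (ca_wedgeE C2 (caP A)) /ca_vec Ap /=.
  by rewrite /ext_mul addrC addKr.
have qj_ir : (q A ∘ j) ∘ (r ∘ i A) = id1 _.
  by rewrite compA -(compA _ j) jr -!compA spl_qi comp1r spl_qi.
have ri_qj : (r ∘ i A) ∘ (q A ∘ j) = id1 _.
  by rewrite compA -(compA _ (i A)) -jr -!compA rj comp1r rj.
have iqj : i A ∘ (q A ∘ j) = j by rewrite compA -jr -compA rj comp1r.
have gP : is_vpa_mor V (PhiF A) (q A ∘ j).
  split; rewrite /= -compA -tensmM iqj.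
    rewrite /ext_cup compDl -!compA -!tensmM pj rj tensm1 tensm0 comp0r.
    by rewrite add0r comp1r.
  by rewrite Aw /ext_vec -!compA -tensmM rj tensm1 comp1r.
(* The inverse of a structure-preserving isomorphism preserves the structure. *)
have fP : is_vpa_mor (PhiF A) V (r ∘ i A).
  have [gc gw] := gP; split.
    by rewrite -gc -[LHS]compA -tensmM qj_ir tensm1 comp1r.
  rewrite -[LHS]comp1l -ri_qj -[LHS]compA (compA (q A ∘ j)) -gw.
  by rewrite -[X in _ ∘ X]compA -tensmM qj_ir tensm1 comp1r.
exists A, (VPAHom fP), (VPAHom gP).
by split; apply: vpa_hom_inj; rewrite /= ?qj_ir ?ri_qj.
Qed.

End Equivalence.

Theorem theorem24 (C : braided_additive)
    (sums : has_finite_direct_sums C)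
    (split : idempotents_split C)
    (C2 : two_invertible C)
    (s : forall A : calg C, splitting (ca_im A)) :
  exists (Phi_dataP : forall A : calg C, is_vpa (Phi_data C2 s A))
         (Phi_morP : forall (A B : calg C) (f : ca_hom A B),
            is_vpa_mor (Phi_data C2 s A) (Phi_data C2 s B)
              (Phi_mor C2 s (ca_hom_val f))),
    is_equivalence (Phi Phi_dataP Phi_morP).
Proof.
exists (Phi_data_vpa C2 s), (@Phi_mor_vpa C C2 s).
apply: fully_faithful_equivalence.
- exact: Phi_full.
- exact: Phi_faithful.
- exact: Phi_essentially_surjective sums.
Qed.
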